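(* Let $\alpha\in\mathbb{R}$ and let $L$ be slowly varying at infinity. If $f\in\mathcal{D}^{*\prime}$ has quasiasymptotic behavior at infinity in $\mathcal{D}^{*\prime}$ with respect to $\lambda^{\alpha}L(\lambda)$, then $f\in\mathcal{Z}^{\prime *}$ and it has the same quasiasymptotic behavior in $\mathcal{Z}^{\prime *}$.
   Context: $\mathbb{N}=\{0,1,2,\dots\}$. Weight sequence: $(M_p)_{p\in\mathbb{N}}$ is a fixed sequence of positive numbers satisfying Komatsu's conditions (M.1) $M_p^2\le M_{p-1}M_{p+1}$ for $p\ge1$; (M.2) there are $A,H>0$ with $M_p\le AH^p\min_{0\le q\le p}M_qM_{p-q}$ for all $p$; (M.3) there is $A>0$ with $\sum_{q=p+1}^\infty M_{q-1}/M_q\le A\,pM_p/M_{p+1}$ for $p\ge1$. Spaces: the symbol $*$ denotes either $(M_p)$ (Beurling case) or $\{M_p\}$ (Roumieu case). $\mathcal{D}^{(M_p)}$ (resp. $\mathcal{D}^{\{M_p\}}$) is the space of compactly supported $\varphi\in C^\infty(\mathbb{R})$ such that for every $h>0$ (resp. some $h>0$) $\sup_{x\in\mathbb{R},p\in\mathbb{N}}|\varphi^{(p)}(x)|/(h^pM_p)<\infty$, with its usual locally convex topology (inductive limit over compact $K$ of the spaces $\mathcal D^*_K$ of elements supported in $K$, where $\mathcal D^*_K$ is the projective limit as $h\to0^+$, resp. inductive limit as $h\to\infty$, of the Banach spaces with norms $\sup_{x\in K,p}|\varphi^{(p)}(x)|/(h^pM_p)$). $\mathcal{D}^{*\prime}$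 is its dual (ultradistributions). For $n\in\mathbb{N}$, $h>0$, $\mathcal{Z}_n^{M_p,h}$ is the Banach space of all $\varphi\in C^\infty(\mathbb{R})$ with $$\|\varphi\|_{M_p,n,h}=\sup_{x\in\mathbb{R},m\in\mathbb{N}}\frac{(1+|x|)^{n+m}|\varphi^{(m)}(x)|}{h^mM_m}<\infty.$$ Put $\mathcal{Z}_n^{(M_p)}=\varprojlim_{h\to0^+}\mathcal{Z}_n^{M_p,h}$, $\mathcal{Z}_n^{\{M_p\}}=\varinjlim_{h\to\infty}\mathcal{Z}_n^{M_p,h}$, and $\mathcal{Z}^*=\varprojlim_{n\in\mathbb{N}}\mathcal{Z}_n^*$; $\mathcal{Z}^{\prime *}$ is the dual of $\mathcal{Z}^*$. Since $\mathcal{D}^*\subset\mathcal{Z}^*$ continuously and densely, $\mathcal{Z}^{\prime *}$ is regarded as a subspace of $\mathcal{D}^{*\prime}$; $f\in\mathcal{Z}^{\prime *}$ means that $f$ extends to a continuous linear functional on $\mathcal{Z}^*$. Slow variation: a real-valued measurable $L$ is slowly varying at infinity if it is positive for large arguments and $L(ax)\sim L(x)$ as $x\to\infty$ for every $a>0$. Quasiasymptotics: $\langle f(\lambda x),\phi(x)\rangle=\lambda^{-1}\langle f(x),\phi(x/\lambda)\rangle$. For $\mathcal{F}=\mathcal{D}^*$ or $\mathcal{F}=\mathcal{Z}^*$ with dual $\mathcal{F}'$, $f\in\mathcal{F}'$ has quasiasymptotic behavior at infinity in $\mathcal{F}'$ with respect to $\lambda^\alpha L(\lambda)$ if there is $g\in\mathcal{F}'$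 such that $\lim_{\lambda\to\infty}\langle f(\lambda x)/(\lambda^\alpha L(\lambda)),\phi(x)\rangle=\langle g,\phi\rangle$ for all $\phi\in\mathcal{F}$; this is written $f(\lambda x)\sim\lambda^\alpha L(\lambda)g(x)$ in $\mathcal{F}'$. ''The same'' quasiasymptotic behavior means with the same $\alpha$, $L$ and $g$. *)

(* Defs.v *)
From HB Require Import structures.
From mathcomp Require Import all_boot all_order all_algebra.
From mathcomp Require Import all_classical all_reals all_analysis.
From mathcomp Require Import measurable_realfun complex.

Set Implicit Arguments.
Unset Strict Implicit.
Unset Printing Implicit Defensive.

Import Order.TTheory GRing.Theory Num.Theory.
Import numFieldNormedType.Exports.

Local Open Scope classical_set_scope.
Local Open Scope ring_scope.

(* Complex numbers as a normed space over R, with the modulus as an R-valued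
   norm: derivatives of functions R -> Rcomplex R are then the library's. *)
Section Rcomplex_normedModType.
Variable R : rcfType.

Lemma Rcomplex_normrZ (l : R) (z : Rcomplex R) : `|l *: z| = `|l| * `|z|.
Proof.
case: z => a b; rewrite /GRing.scale/= /Num.norm/= /Normc.normc/=.
by rewrite !exprMn -mulrDr sqrtrM ?sqr_ge0// sqrtr_sqr.
Qed.

HB.instance Definition _ :=
  PseudoMetric.copy (Rcomplex R) (pseudoMetric_normed (Rcomplex R)).
HB.instance Definition _ := isPointed.Build (Rcomplex R) 0.
HB.instance Definition _ := NormedZmod_PseudoMetric_eq.Build R (Rcomplex R) erefl.
HB.instance Definition _ :=
  PseudoMetricNormedZmod_Lmodule_isNormedModule.Build R (Rcomplex R)
    Rcomplex_normrZ.

End Rcomplex_normedModType.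

Section locally_convex_function_spaces.
Variable R : realType.
Notation C := (Rcomplex R).
Notation fct := (R -> C).

(* A locally convex space of functions: [carrier] is the underlying set and
   [nbhs0] the filter of neighbourhoods of 0.  Membership of U in [nbhs0] only
   depends on the trace of U on [carrier]. *)
Record lcspace := LCSpace {
  carrier : set fct ;
  nbhs0 : set_system fct }.

Definition lcnbhs (E : lcspace) (phi : fct) : set_system fct :=
  [set U | nbhs0 E [set psi | U (fun x => phi x + psi x)]].

(* The subspace of D on which the extended norm [N] is finite. *)
Definition normed_space (D : set fct) (N : fct -> \bar R) : lcspace :=
  let E := [set phi | D phi /\ (N phi < +oo)%E] in
  LCSpace E [set U | exists2 e : R, 0 < e &
    forall phi, E phi -> (N phi < e%:E)%E -> U phi].

(* Intersection of the E i, i \in I, with the coarsest topology making all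
   inclusions into the E i continuous. *)
Definition projlim (T : Type) (I : set T) (E : T -> lcspace) : lcspace :=
  let F := \bigcap_(i in I) carrier (E i) in
  LCSpace F [set U | exists (J : set T) (V : T -> set fct),
    [/\ finite_set J, J `<=` I, forall i, J i -> nbhs0 (E i) (V i)
      & F `&` \bigcap_(i in J) V i `<=` U]].

Definition absolutely_convex (V : set fct) : Prop :=
  V !=set0 /\ forall (a b : C) (phi psi : fct), `|a| + `|b| <= 1 ->
    V phi -> V psi -> V (fun x => a * phi x + b * psi x).

(* Union of the (directed) family E i, i \in I, with the finest locally convex
   topology making all inclusions of the E i continuous. *)
Definition indlim (T : Type) (I : set T) (E : T -> lcspace) : lcspace :=
  LCSpace (\bigcup_(i in I) carrier (E i))
    [set U | exists V : set fct,
      [/\ absolutely_convex V, forall i, I i -> nbhs0 (E i) V & V `<=` U]].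

(* Continuous linear functionals on E; values off the carrier are irrelevant. *)
Definition dual (E : lcspace) (f : fct -> C) : Prop :=
  (forall (a : C) (phi psi : fct), carrier E phi -> carrier E psi ->
     f (fun x => a * phi x + psi x) = a * f phi + f psi) /\
  (forall phi : fct, carrier E phi -> f @ lcnbhs E phi --> f phi).

(* The functional f(lambda x). *)
Definition dilate (lambda : R) (f : fct -> C) : fct -> C :=
  fun phi => lambda^-1 *: f (fun x => phi (x / lambda)).

(* f(lambda x) ~ lambda^alpha L(lambda) g(x) in the dual of E. *)
Definition quasiasymptotic (E : lcspace) (alpha : R) (L : R -> R)
    (f g : fct -> C) : Prop :=
  [/\ dual E f, dual E g & forall phi, carrier E phi ->
    (lambda `^ alpha * L lambda)^-1 *: dilate lambda f phi
      @[lambda --> +oo] --> g phi].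

End locally_convex_function_spaces.

Section ultradifferentiable_functions.
Variable R : realType.
Notation C := (Rcomplex R).
Notation fct := (R -> C).

Definition weight_sequence (M : nat -> R) : Prop :=
  [/\ forall p, 0 < M p,
      forall p, (0 < p)%N -> M p ^+ 2 <= M p.-1 * M p.+1,
      exists A H : R, [/\ 0 < A, 0 < H & forall p q, (q <= p)%N ->
        M p <= A * H ^+ p * (M q * M (p - q)%N)]
    & exists2 A : R, 0 < A & forall p, (0 < p)%N ->
        (\sum_(p.+1 <= q <oo) (M q.-1 / M q)%:E
           <= (A * p%:R * M p / M p.+1)%:E)%E].

Definition smooth (phi : fct) : Prop :=
  forall (m : nat) (x : R), derivable (derive1n m phi) x 1.

Variant ultra_kind := Beurling | Roumieu.

Definition kind_limit (k : ultra_kind) (E : R -> lcspace R) : lcspace R :=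
  match k with
  | Beurling => projlim [set h | 0 < h] E
  | Roumieu => indlim [set h | 0 < h] E
  end.

Definition D_norm (M : nat -> R) (K : set R) (h : R) (phi : fct) : \bar R :=
  ereal_sup [set (`|derive1n xm.2 phi xm.1| / (h ^+ xm.2 * M xm.2))%:E
            | xm in [set xm : R * nat | K xm.1]].

Definition D_space (k : ultra_kind) (M : nat -> R) : lcspace R :=
  indlim [set K : set R | compact K] (fun K => kind_limit k (fun h =>
    normed_space
      [set phi | smooth phi /\ closure [set x | phi x != 0] `<=` K]
      (D_norm M K h))).

Definition Z_norm (M : nat -> R) (n : nat) (h : R) (phi : fct) : \bar R :=
  ereal_sup [set ((1 + `|xm.1|) ^+ (n + xm.2) * `|derive1n xm.2 phi xm.1|
                    / (h ^+ xm.2 * M xm.2))%:E | xm in [set: R * nat]].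

Definition Z_space (k : ultra_kind) (M : nat -> R) : lcspace R :=
  projlim [set: nat] (fun n => kind_limit k (fun h =>
    normed_space [set phi | smooth phi] (Z_norm M n h))).

(* Measurability is Lebesgue measurability (completed sigma-algebra), on the
   positive half-line. *)
Definition slowly_varying (L : R -> R) : Prop :=
  [/\ measurable_fun
        (`]0, +oo[ : set (g_sigma_algebraType
                            (completed_algebra_gen (@lebesgue_measure R)))) L,
      \forall x \near +oo, 0 < L x
    & forall a : R, 0 < a -> L (a * x) / L x @[x --> +oo] --> (1 : R)].

End ultradifferentiable_functions.

(* Main.v *)
Require Import Defs.
From mathcomp Require Import all_boot all_order all_algebra.
From mathcomp Require Import all_classical all_reals all_analysis.
From mathcomp Require Import complex.
From mathcomp Require Import ring lra.

(* Cut a function phi of Z^* dyadically with an ultradifferentiable cutoff chi,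
   which exists because (M.3) implies non-quasianalyticity.  With
   psi = chi - chi(2 .), the k-th ring of phi is the dilation by 2^k of
   theta_k(y) = psi(y) phi(2^k y), all theta_k being supported in [-2, 2].  The
   weights (1 + |x|)^(n+m) make their norms in D^* of order 2^(-kn), since each
   factor 2^k produced by a derivative is absorbed by one factor 1 + |x|.
   The functionals f(mu x) / (mu^alpha L(mu)), mu >= mu_0, converge pointwise,
   hence are equicontinuous on D^*_[-2,2] by Banach-Steinhaus; taking
   mu = 2^k lambda and using L(2^k lambda) <= 2^k L(lambda), the k-th ring
   contributes at most C 2^(-k) to f(lambda x) / (lambda^alpha L(lambda)) as soon
   as n >= alpha + 3, uniformly in large lambda.  So the limits of f and of g along
   the cutoffs chi(x / 2^k) exist, are continuous on Z^*, and the limit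
   lambda -> oo may be taken ring by ring.

   Both kinds of spaces are handled through the classes of functions bounded for
   every h > a: a = 0 is the Beurling case, and the Roumieu space is the union of
   the classes with a > 0. *)

Set Implicit Arguments.
Unset Strict Implicit.
Unset Printing Implicit Defensive.

Import Order.TTheory GRing.Theory Num.Theory.
Import numFieldNormedType.Exports.

Local Open Scope classical_set_scope.
Local Open Scope ring_scope.

(** * Derivatives of vector-valued functions *)

(** The limit of f(lambda x) is known only along one test function at a time, with a threshold on
    lambda that depends on it. Banach-Steinhaus trades this for one threshold and one seminorm on
    [-2, 2], and the dilation mu = 2^k lambda brings every ring there, so that far rings and large
    lambda are the same regime. This is also why f itself extends: at lambda = 1 all but finitely
    many rings have mu above the threshold, and the remaining ones form one compactly supported
    function. The extension is defined by the dyadic cutoffs chi(x / 2^k), but evaluating it on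
    phi(x / lambda) cuts phi at the radii 2^k / lambda. Unless lambda is a power of 2, these radii
    are not dyadic; hence the rings are estimated for chi - chi(s .), uniformly in s in [1, 2].
    Nested balls need complete spaces with countably many seminorms. The classes with bounds for
    every h > a provide them in both cases, and since chi has bounds for every h > 0, passing to
    rings only replaces a by 3a. *)

Section derivatives.
Variables (R : realType) (V : normedModType R).
Implicit Types (f g : R -> V) (u : R -> R).

Lemma is_derive_epsP f (x : R) (d : V) :
  is_derive x 1 f d <->
  forall e : R, 0 < e -> exists2 r : R, 0 < r &
    forall h, `|h| < r -> `|f (x + h) - f x - h *: d| <= e * `|h|.
Proof.
split.
- move=> [dv <-] e e0.
  have /cvgrPdist_le /(_ e e0) : (fun h : R => h^-1 *: (f (h *: 1 + x) - f x)) @ 0^' --> 'D_1 f x.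
    exact: dv.
  case=> r /= r0 H; exists r => // h hr.
  have [->|h0] := eqVneq h 0.
    by rewrite addr0 subrr scale0r subrr normr0 normr0 mulr0.
  have := H h; rewrite /= sub0r normrN => /(_ hr h0).
  rewrite [h%:A]mulr1 [h + x]addrC => le.
  rewrite -[f (x + h) - f x](scalerKV h0) -scalerBr normrZ mulrC.
  by rewrite ler_pM2r ?normr_gt0// distrC.
- move=> H.
  have K : (fun h : R => h^-1 *: (f (h *: 1 + x) - f x)) @ 0^' --> d.
    apply/cvgrPdist_le => e e0; have [r r0 Hr] := H e e0.
    exists r => // h; rewrite /= sub0r normrN => hr h0.
    rewrite [h%:A]mulr1 [h + x]addrC.
    have := Hr h hr; rewrite -[f (x + h) - f x](scalerKV h0) -scalerBr normrZ mulrC.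
    by rewrite ler_pM2r ?normr_gt0// scalerKV// distrC.
  apply: DeriveDef; first by apply/cvg_ex; exists d.
  exact: cvg_lim K.
Qed.

Lemma is_derive_continuous f (x : R) d : is_derive x 1 f d -> {for x, continuous f}.
Proof. by move=> [df _]; apply/differentiable_continuous/derivable1_diffP. Qed.

Lemma is_derive_scale u f (x du : R) (df : V) :
  is_derive x 1 u du -> is_derive x 1 f df ->
  is_derive x 1 (fun y => u y *: f y) (du *: f x + u x *: df).
Proof.
move=> hu hf.
pose r := (fun h => h^-1 *: (u (h *: 1 + x) *: f (h *: 1 + x) - u x *: f x)).
suff K : r @ 0^' --> du *: f x + u x *: df.
  by apply: DeriveDef; [apply/cvg_ex; eexists; exact: K|exact: cvg_lim K].
have -> : r = fun h => (h^-1 * (u (h *: 1 + x) - u x)) *: f (h *: 1 + x)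
    + u x *: (h^-1 *: (f (h *: 1 + x) - f x)).
  apply/funext => h; rewrite /r -scalerA [u x *: (_ *: _)]scalerA [u x * _]mulrC -scalerA.
  by rewrite -scalerDr; congr (_ *: _); rewrite scalerBl scalerBr addrA subrK.
case: hu => du1 <-; case: hf => df1 <-.
apply: cvgD; last by apply: cvgZr; exact: df1.
apply: cvgZ; first exact: du1.
suff : {for 0, continuous (fun h : R => f (h *: 1 + x))}.
  by move=> /continuous_withinNx; rewrite scale0r add0r.
exact/differentiable_continuous/derivable1_diffP/(derivable1P _ _ _).1.
Qed.

Lemma is_derive_affine f (a b x : R) d :
  is_derive (a * x + b) 1 f d -> is_derive x 1 (fun y => f (a * y + b)) (a *: d).
Proof.
move=> /is_derive_epsP H; apply/is_derive_epsP => e e0.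
have a1 : 0 < `|a| + 1 by rewrite ltr_pwDr.
have [r r0 Hr] := H (e / (`|a| + 1)) (divr_gt0 e0 a1).
exists (r / (`|a| + 1)); first exact: divr_gt0.
move=> h; rewrite ltr_pdivlMr// => hr.
have := Hr (a * h); rewrite normrM => /(_ _).
rewrite (_ : a * (x + h) + b = a * x + b + a * h); last by ring.
rewrite scalerA [h * a]mulrC => K; apply: le_trans (K _) _.
  by apply: le_lt_trans hr; rewrite mulrC ler_wpM2l// lerDl.
rewrite mulrA ler_wpM2r// mulrAC ler_pdivrMr// ler_wpM2l ?ltW//.
by rewrite ltrDl.
Qed.

(** An explicit candidate for all derivatives of [d 0] at once: estimates are made on the candidate
    and transferred to [derive1n] by uniqueness of derivatives. *)
Definition jet (d : nat -> R -> V) := forall m (x : R), is_derive x 1 (d m) (d m.+1 x).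

Lemma jet_derive1n d m : jet d -> derive1n m (d 0%N) = d m.
Proof.
move=> jd; elim: m => // m IH; rewrite derive1nS IH; apply/funext => x.
by rewrite derive1E; have [_ ->] := jd m x.
Qed.

Lemma jet_dilate d (s : R) : jet d -> jet (fun m x => s ^+ m *: d m (s * x)).
Proof.
move=> jd m x; have := jd m (s * x + 0) => /is_derive_affine h.
have /= := is_deriveZ (s ^+ m) h; rewrite addr0 scalerA -exprSr.
rewrite (_ : (_ \*: _) = (fun x => s ^+ m *: d m (s * x)))//.
by apply/funext => y /=; rewrite addr0.
Qed.

(** Leibniz's rule as a recursion: each derivative falls on one factor or the other, giving [2 ^ m]
    products and no binomial coefficients. *)
Fixpoint prodjet (m : nat) (du : nat -> R -> R) (d : nat -> R -> V) : R -> V :=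
  if m is m'.+1 then fun x => prodjet m' (fun i => du i.+1) d x + prodjet m' du (fun i => d i.+1) x
  else fun x => du 0%N x *: d 0%N x.

End derivatives.

(** * Derivatives of products and their growth *)

Section products.
Variables (R : realType) (V : normedModType R).

Lemma prodjet_jet (du : nat -> R -> R) (d : nat -> R -> V) :
  jet (V := R) du -> jet d -> jet (fun m => prodjet m du d).
Proof.
move=> ju jd m; elim: m du d ju jd => [|m IH] du d ju jd x /=.
  exact: is_derive_scale.
by apply: is_deriveD; apply: IH.
Qed.

(** The offsets [i] and [j] count the derivatives already spent on each factor, which makes the
    induction go through. The two branches contribute factors [a] and [b], which add up to
    [(a + b) ^+ m]; the product of weights is merged only when no derivative is left. *)
Lemma prodjet_bound (M : nat -> R) (du : nat -> R -> R) (d : nat -> R -> V)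
    (A B a b x : R) i j m :
  (forall p q, M p * M q <= M 0%N * M (p + q)%N) -> (forall p, 0 < M p) ->
  0 <= A -> 0 <= B -> 0 <= a -> 0 <= b ->
  (forall l, `|du l x| <= A * (a ^+ l * M (l + i)%N)) ->
  (forall l, `|d l x| <= B * (b ^+ l * M (l + j)%N)) ->
  `|prodjet m du d x| <= A * B * M 0%N * ((a + b) ^+ m * M (m + i + j)%N).
Proof.
move=> MM M0 A0 B0 a0 b0; elim: m du d A B i j A0 B0 => [|m IH] du d A B i j A0 B0 hu hd.
  rewrite /= normrZ expr0 mul1r.
  apply: le_trans (ler_pM _ _ (hu 0%N) (hd 0%N)) _ => //.
  rewrite !expr0 !mul1r !add0n.
  rewrite [leLHS](_ : _ = A * B * (M i * M j)); last by ring.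
  by rewrite -[leRHS]mulrA ler_wpM2l ?mulr_ge0.
apply: le_trans (ler_normD _ _) _.
have h1 : `|prodjet m (fun i => du i.+1) d x| <=
    (A * a) * B * M 0%N * ((a + b) ^+ m * M (m + i.+1 + j)%N).
  apply: IH => //; first exact: mulr_ge0.
  by move=> l; apply: le_trans (hu _) _; rewrite exprS addnS addSn -!mulrA.
have h2 : `|prodjet m du (fun i => d i.+1) x| <=
    A * (B * b) * M 0%N * ((a + b) ^+ m * M (m + i + j.+1)%N).
  apply: IH => //; first exact: mulr_ge0.
  by move=> l; apply: le_trans (hd _) _; rewrite exprS addnS addSn -!mulrA.
apply: le_trans (lerD h1 h2) _.
rewrite !addnS !addSn exprS le_eqVlt; apply/orP; left; apply/eqP; ring.
Qed.

End products.

(** * Termwise differentiation of real sequences *)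

Section real_limits.
Variable R : realType.

Lemma mean_value (f df : R -> R) (a b : R) : a <= b ->
  (forall x : R, is_derive x 1 f (df x)) ->
  exists2 c, a <= c <= b & f b - f a = df c * (b - a).
Proof.
move=> ab Df.
have fc : {within `[a, b], continuous f}.
  by apply: continuous_subspaceT => y; exact: is_derive_continuous (Df y).
have [c] := @MVT_segment R f df a b ab (fun x _ => Df x) fc.
by rewrite in_itv => cab E; exists c.
Qed.

Lemma mean_value_le (f df : R -> R) (K : R) :
  (forall x : R, is_derive x 1 f (df x)) -> (forall x, `|df x| <= K) ->
  forall x y, `|f x - f y| <= K * `|x - y|.
Proof.
move=> Df dK.
have H x y : x <= y -> `|f y - f x| <= K * `|y - x|.
  move=> xy; have [c _ ->] := mean_value xy Df.
  by rewrite normrM ler_wpM2r.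
move=> x y; have [xy|/ltW xy] := leP x y; last exact: H.
by rewrite distrC [`|x - y|]distrC; exact: H.
Qed.

(** The mean value inequality bounds the increment of [F m - F n] by [e / 2 * |h|] uniformly in [m].
    Letting [m] tend to infinity replaces [F m] by [f], so only the derivatives have to converge
    uniformly. *)
Lemma real_is_derive_lim (F dF : nat -> R -> R) (f df : R -> R) N0 :
  (forall n (x : R), (N0 <= n)%N -> is_derive x 1 (F n) (dF n x)) ->
  (forall x, F ^~ x @ \oo --> f x) ->
  (forall e, 0 < e -> exists N, forall n x, (N <= n)%N -> `|dF n x - df x| <= e) ->
  forall x : R, is_derive x 1 f (df x).
Proof.
move=> D Ff dFf x; apply/is_derive_epsP => e e0.
have e4 : 0 < e / 4 by lra.
have [N HN] := dFf _ e4.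
pose n := maxn N N0.
have nN : (N <= n)%N by rewrite leq_maxl.
have nN0 : (N0 <= n)%N by rewrite leq_maxr.
have [r r0 Hr] := (is_derive_epsP _ _ _).1 (D n x nN0) _ e4.
exists r => // h hr.
have K : `|(f (x + h) - F n (x + h)) - (f x - F n x)| <= e / 2 * `|h|.
  pose w m := `|(F m (x + h) - F n (x + h)) - (F m x - F n x)|.
  have cw : w @ \oo --> `|(f (x + h) - F n (x + h)) - (f x - F n x)|.
    apply: cvg_norm; apply: cvgB; (apply: cvgB; [exact: Ff|exact: cvg_cst]).
  rewrite -(cvg_lim _ cw)//; apply: limr_le; first by apply/cvg_ex; eexists; exact: cw.
  near=> m.
  have mn : (n <= m)%N by near: m; exists n.
  have mN := leq_trans nN mn; have mN0 := leq_trans nN0 mn.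
  have := @mean_value_le (fun y => F m y - F n y) (fun y => dF m y - dF n y) (e / 2) _ _ (x + h) x.
  rewrite [x + h - x]addrAC subrr add0r; apply.
    by move=> y; apply: is_deriveB; exact: D.
  move=> y; rewrite (_ : dF m y - dF n y = (dF m y - df y) - (dF n y - df y)); last by ring.
  by apply: le_trans (ler_normB _ _) _; have := HN m y mN; have := HN n y nN; lra.
have K2 := Hr h hr.
have K3 : `|h *: (dF n x - df x)| <= e / 4 * `|h|.
  by rewrite normrZ mulrC ler_wpM2r// HN.
rewrite (_ : _ - _ - _ = ((f (x + h) - F n (x + h)) - (f x - F n x))
   + (F n (x + h) - F n x - h *: dF n x) + h *: (dF n x - df x)); last first.
  by rewrite /GRing.scale/=; ring.
apply: le_trans (ler_normD _ _) _; apply: le_trans (lerD (ler_normD _ _) (lexx _)) _.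
by move: K K2 K3; lra.
Unshelve. all: by end_near. Qed.

End real_limits.

(** * Complex-valued functions through their real and imaginary parts *)

Section complex_limits.
Variable R : realType.
Notation C := (Rcomplex R).
Notation Re := (@complex.Re R).
Notation Im := (@complex.Im R).

Lemma Rcomplex_normE (z : C) : `|z| = Num.sqrt (Re z ^+ 2 + Im z ^+ 2).
Proof. by case: z. Qed.

Lemma normRe_le (z : C) : `|Re z| <= `|z|.
Proof. by rewrite Rcomplex_normE -sqrtr_sqr ler_wsqrtr// lerDl sqr_ge0. Qed.

Lemma normIm_le (z : C) : `|Im z| <= `|z|.
Proof. by rewrite Rcomplex_normE -sqrtr_sqr ler_wsqrtr// lerDr sqr_ge0. Qed.

Lemma norm_le_ReIm (z : C) : `|z| <= `|Re z| + `|Im z|.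
Proof.
rewrite Rcomplex_normE -[leRHS]ger0_norm ?addr_ge0// -[leRHS]sqrtr_sqr ler_wsqrtr//.
rewrite sqrrD !real_normK ?num_real// lerD2r lerDl mulrn_wge0// mulr_ge0//.
Qed.

Lemma Rcomplex_normM (z w : C) : `|(z * w : C)| = `|z| * `|w|.
Proof. exact: Normc.normcM. Qed.

Lemma ReB (z w : C) : Re (z - w) = Re z - Re w. Proof. exact: (raddfB Re). Qed.
Lemma ImB (z w : C) : Im (z - w) = Im z - Im w. Proof. exact: (raddfB Im). Qed.
Lemma ReZ a (z : C) : Re (a *: z) = a * Re z. Proof. by case: z. Qed.
Lemma ImZ a (z : C) : Im (a *: z) = a * Im z. Proof. by case: z. Qed.

(** The mean value theorem is an equality only for real functions; the splitting carries its
    consequences over to complex values. *)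
Lemma is_derive_ReP (f : R -> C) (x : R) d : is_derive x 1 f d <->
  is_derive x 1 (Re \o f) (Re d) /\ is_derive x 1 (Im \o f) (Im d).
Proof.
split.
  move=> /is_derive_epsP H; split; apply/is_derive_epsP => e /H [r r0 Hr]; exists r => // h /Hr;
  apply: le_trans.
    by apply: le_trans (normRe_le _); rewrite !ReB ReZ.
  by apply: le_trans (normIm_le _); rewrite !ImB ImZ.
move=> [/is_derive_epsP H1 /is_derive_epsP H2]; apply/is_derive_epsP => e e0.
have e2 : 0 < e / 2 by lra.
have [r1 r10 h1] := H1 _ e2; have [r2 r20 h2] := H2 _ e2.
exists (Num.min r1 r2); first by rewrite lt_min r10.
move=> h; rewrite lt_min => /andP[/h1 k1 /h2 k2].
apply: le_trans (norm_le_ReIm _) _; rewrite !ReB ReZ !ImB ImZ.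
by move: k1 k2; rewrite /= /GRing.scale/=; lra.
Qed.

Lemma Rcomplex_cvgP (u : nat -> C) (l : C) : u @ \oo --> l <->
  ((Re \o u) @ \oo --> Re l) /\ ((Im \o u) @ \oo --> Im l).
Proof.
split.
  move=> /cvgrPdist_le H; split; apply/cvgrPdist_le => e /H; apply: filterS => n;
  apply: le_trans.
    by apply: le_trans (normRe_le _); rewrite !ReB.
  by apply: le_trans (normIm_le _); rewrite !ImB.
move=> [/cvgrPdist_le H1 /cvgrPdist_le H2]; apply/cvgrPdist_le => e e0.
have e2 : 0 < e / 2 by lra.
apply: filterS2 (H1 _ e2) (H2 _ e2) => n h1 h2.
apply: le_trans (norm_le_ReIm _) _; rewrite !ReB !ImB.
by move: h1 h2; rewrite /=; lra.
Qed.

Lemma jet_smooth (d : nat -> R -> C) : jet d -> smooth (d 0%N).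
Proof. by move=> jd m x; rewrite jet_derive1n//; have [] := jd m x. Qed.

Lemma smooth_jet (f : R -> C) : smooth f -> jet (fun m => derive1n m f).
Proof. by move=> sf m x; apply: DeriveDef; [exact: sf|rewrite derive1nS derive1E]. Qed.

Lemma RcomplexZ (t : R) (z : C) : t *: z = (Complex t 0 : C) * z.
Proof.
case: z => x y; rewrite /GRing.scale/= /GRing.mul/=.
by rewrite !mul0r subr0 addr0.
Qed.

Lemma is_derive_mulC (a : C) (f : R -> C) (x : R) (d : C) :
  is_derive x 1 f d -> is_derive x 1 (fun y => a * f y) (a * d).
Proof.
move=> /is_derive_epsP H; apply/is_derive_epsP => e e0.
have a1 : 0 < `|a| + 1 by rewrite ltr_pwDr.
have [r r0 Hr] := H (e / (`|a| + 1)) (divr_gt0 e0 a1).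
exists r => // h /Hr K.
rewrite (_ : _ - _ - _ = a * (f (x + h) - f x - h *: d)); last first.
  by rewrite !mulrBr !RcomplexZ [a * (_ * _)]mulrCA.
rewrite Rcomplex_normM; apply: le_trans (ler_wpM2l (normr_ge0 _) K) _.
rewrite mulrA ler_wpM2r// mulrCA ger_pMr// ler_pdivrMr// mul1r.
by rewrite lerDl.
Qed.

Lemma Rcomplex_normr (t : R) : `|Complex t 0 : C| = `|t|.
Proof. by rewrite Rcomplex_normE/= expr0n addr0 sqrtr_sqr. Qed.

Lemma complex_is_derive_lim (F dF : nat -> R -> C) (f df : R -> C) :
  (forall n (x : R), is_derive x 1 (F n) (dF n x)) ->
  (forall x, F ^~ x @ \oo --> f x) ->
  (forall e, 0 < e -> exists N, forall n x, (N <= n)%N -> `|dF n x - df x| <= e) ->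
  forall x : R, is_derive x 1 f (df x).
Proof.
move=> D Ff dFf x; apply/is_derive_ReP; split.
- apply: (@real_is_derive_lim _ (fun n => Re \o F n) (fun n => Re \o dF n)
    (Re \o f) (Re \o df) 0%N) x.
  + by move=> n x _; have /is_derive_ReP[] := D n x.
  + by move=> x; have /Rcomplex_cvgP[] := Ff x.
  + move=> e /dFf[N HN]; exists N => n x nN; apply: le_trans (HN n x nN).
    by apply: le_trans (normRe_le _); rewrite ReB.
- apply: (@real_is_derive_lim _ (fun n => Im \o F n) (fun n => Im \o dF n)
    (Im \o f) (Im \o df) 0%N) x.
  + by move=> n x _; have /is_derive_ReP[] := D n x.
  + by move=> x; have /Rcomplex_cvgP[] := Ff x.
  + move=> e /dFf[N HN]; exists N => n x nN; apply: le_trans (HN n x nN).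
    by apply: le_trans (normIm_le _); rewrite ImB.
Qed.

Lemma real_cauchy_lim (u : nat -> R) (e : nat -> R) :
  e @ \oo --> (0 : R) -> (forall n m, (n <= m)%N -> `|u m - u n| <= e n) ->
  exists l : R, u @ \oo --> l.
Proof.
move=> e0 H; suff : cvgn u by move=> /cvg_ex.
apply/cauchy_cvgP/cauchy_exP => eps eps0.
have /cvgrPdist_lt /(_ _ eps0) [N _ HN] := e0.
exists (u N); exists N => //= m /= Nm; rewrite -ball_normE /= distrC.
apply: le_lt_trans (H _ _ Nm) _; apply: le_lt_trans (ler_norm _) _.
by have := HN N (leqnn N); rewrite /= sub0r normrN.
Qed.

(** Completeness holds componentwise; letting [m] tend to infinity in the Cauchy estimate then
    recovers the rate [e] with no loss. *)
Lemma cauchy_lim (u : nat -> C) (e : nat -> R) :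
  e @ \oo --> (0 : R) -> (forall n m, (n <= m)%N -> `|u m - u n| <= e n) ->
  exists l : C, u @ \oo --> l /\ forall n, `|l - u n| <= e n.
Proof.
move=> e0 H.
have [a ha] : exists a : R, (Re \o u) @ \oo --> a.
  by apply: real_cauchy_lim e0 _ => n m nm; rewrite /= -ReB (le_trans (normRe_le _))// H.
have [b hb] : exists b : R, (Im \o u) @ \oo --> b.
  by apply: real_cauchy_lim e0 _ => n m nm; rewrite /= -ImB (le_trans (normIm_le _))// H.
pose l : C := Complex a b.
have ul : u @ \oo --> l by apply/Rcomplex_cvgP.
exists l; split => // n.
have cw : (fun m => `|u m - u n|) @ \oo --> `|l - u n|.
  by apply: cvg_norm; apply: cvgB => //; exact: cvg_cst.
rewrite -(cvg_lim _ cw)//; apply: limr_le; first by apply/cvg_ex; eexists; exact: cw.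
by exists n => // m nm; exact: H.
Qed.

End complex_limits.

(** * A smooth step with prescribed derivative bounds *)

Section smooth_step.
Variable R : realType.

Definition truncpow (p : nat) (x : R) : R := Num.max x 0 ^+ p / p`!%:R.

Lemma truncpow_is_derive p (x : R) :
  is_derive x 1 (truncpow p.+2) (truncpow p.+1 x).
Proof.
suff H : is_derive x 1 (fun y : R => Num.max y 0 ^+ p.+2) (p.+2%:R * Num.max x 0 ^+ p.+1).
  have -> : truncpow p.+2 = fun y => (p.+2)`!%:R^-1 *: (Num.max y 0 ^+ p.+2).
    by apply/funext => y; rewrite /truncpow mulrC.
  apply: is_derive_eq.
  rewrite /truncpow factS natrM /GRing.scale/=.
  have : p.+2%:R != 0 :> R by rewrite pnatr_eq0.
  have : (p.+1)`!%:R != 0 :> R by rewrite pnatr_eq0 -lt0n fact_gt0.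
  move: (p.+2%:R) ((p.+1)`!%:R) => c1 c2 c20 c10; field; exact/andP.
elim: p => [|p IH].
  (* The remainder of the truncated square is at most [h ^+ 2], so the radius [e] itself works. *)
  apply/is_derive_epsP => e e0; exists e => // h he.
  apply: le_trans (_ : `|h| * `|h| <= _); last by rewrite ler_wpM2r// ltW.
  rewrite -normrM /GRing.scale/= expr1 !expr2 maxEle maxEle ler_norml.
  rewrite -expr2 ger0_norm ?sqr_ge0// expr2.
  by case: ifPn; rewrite -?ltNge => ?; case: ifPn; rewrite -?ltNge => ?; apply/andP; split; nra.
have := @is_derive_scale R R id (fun y : R => Num.max y 0 ^+ p.+2) x 1 _ (is_derive_id _ _) IH.
have -> : (fun y : R => Num.max y 0 ^+ p.+3) = (fun y : R => y * Num.max y 0 ^+ p.+2).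
  apply/funext => y; rewrite [LHS]exprS.
  by have [y0|y0] := leP y 0; rewrite // exprS !mul0r mulr0.
move=> H; apply: is_derive_eq H _.
rewrite /GRing.scale/= mul1r [x * _]mulrCA.
have -> : x * Num.max x 0 ^+ p.+1 = Num.max x 0 ^+ p.+2.
  by rewrite [RHS]exprS; have [x0|x0] := leP x 0; rewrite // exprS !mul0r mulr0.
by rewrite -[X in X + _ = _]mul1r -mulrDl nat1r.
Qed.

(** Applied to a primitive of [v], this is the mean of [v] over [[x - b, x]], that is, the
    convolution of [v] with the uniform density on [[0, b]]. *)
Definition diffquot (b : R) (w : R -> R) (x : R) : R := (w x - w (x - b)) / b.

Variable t : nat -> R.
Hypothesis tdec : forall n, t n.+1 < t n.
Hypothesis tge0 : forall n, 0 <= t n.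
Hypothesis tlim : t @ \oo --> (0 : R).
Let b n := t n - t n.+1.

Let b_gt0 n : 0 < b n.
Proof. by rewrite subr_gt0. Qed.

(* [boxspline n n] is the primitive of the convolution of the [n] uniform
   densities on [0, b j], [j < n]; lowering the second index differentiates. *)
Fixpoint boxspline (n p : nat) : R -> R :=
  if n is n'.+1 then diffquot (b n') (boxspline n' p) else truncpow p.

Lemma boxspline_is_derive n p (x : R) :
  is_derive x 1 (boxspline n p.+2) (boxspline n p.+1 x).
Proof.
elim: n x => [|n IH] x /=; first exact: truncpow_is_derive.
have -> : diffquot (b n) (boxspline n p.+2) =
  fun y => (b n)^-1 *: (boxspline n p.+2 y - boxspline n p.+2 (1 * y + - b n)).
  by apply/funext => y; rewrite /diffquot mulrC mul1r.
have h := is_derive_affine (IH (1 * x + - b n)).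
have H := is_deriveZ (b n)^-1 (is_deriveB (IH x) h).
apply: is_derive_eq H _.
by rewrite /diffquot /GRing.scale/= !mul1r mulrC.
Qed.

(** A derivative turns one averaging into a bare difference quotient, which costs at most [2 / b j];
    this is the price of [q] derivatives. *)
Let Q q := \prod_(j < q) (2 / b j).

Let Q_ge0 q : 0 <= Q q.
Proof. by apply: prodr_ge0 => j _; rewrite divr_ge0// ltW. Qed.

(** The first [q] quotients each cost [2 / b j] on the 1-Lipschitz ramp. Each further quotient comes
    with an integration and costs nothing: the quotient of a function with Lipschitz constant [Q q]
    is bounded by [Q q], hence so is the slope of its primitive. *)
Lemma boxspline_lip q k x y :
  `|boxspline (q + k) k.+1 x - boxspline (q + k) k.+1 y| <= Q q * `|x - y|.
Proof.
elim: k x y => [|k IH] x y.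
  rewrite addn0; elim: q x y => [|q IH] x y.
    rewrite /Q big_ord0 mul1r /= /truncpow !expr1 !divr1 !maxEle.
    have n1 := ler_norm (x - y); have := ler_norm (y - x); rewrite distrC => n2.
    by rewrite ler_norml; case: ifPn; rewrite -?ltNge => ?; case: ifPn;
      rewrite -?ltNge => ?; apply/andP; split; lra.
  rewrite /Q big_ord_recr /= -/(Q q) /diffquot -mulrBl normrM normfV (gtr0_norm (b_gt0 _)).
  rewrite ler_pdivrMr// [leRHS](_ : _ = 2 * (Q q * `|x - y|)); last first.
    by field; rewrite gt_eqF.
  rewrite (_ : _ - _ - _ = (boxspline q 1 x - boxspline q 1 y) -
    (boxspline q 1 (x - b q) - boxspline q 1 (y - b q))); last by ring.
  apply: le_trans (ler_normB _ _) _; have h1 := IH x y; have := IH (x - b q) (y - b q).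
  rewrite (_ : x - b q - (y - b q) = x - y); last by ring.
  by move: h1; lra.
apply: mean_value_le; first by move=> z; exact: boxspline_is_derive.
move=> z; rewrite addnS /= /diffquot normrM normfV (gtr0_norm (b_gt0 _)) ler_pdivrMr//.
by apply: le_trans (IH _ _) _; rewrite opprB addrCA subrr addr0 (gtr0_norm (b_gt0 _)).
Qed.

Lemma boxspline_bound q k x : `|boxspline (q + k).+1 k.+1 x| <= Q q.
Proof.
rewrite /= /diffquot normrM normfV (gtr0_norm (b_gt0 _)) ler_pdivrMr//.
apply: le_trans (boxspline_lip _ _ _ _) _.
by rewrite opprB addrCA subrr addr0 (gtr0_norm (b_gt0 _)).
Qed.

(** A difference quotient is a derivative at an intermediate point, so one more convolution only
    moves the argument to the left by at most [b n]. *)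
Lemma boxspline_step n p x : exists2 y, x - b n <= y <= x &
  boxspline n.+1 p.+2 x = boxspline n p.+1 y.
Proof.
have [|c cx E] := mean_value _ (boxspline_is_derive n p) (a := x - b n) (b := x).
  by rewrite lerBlDr lerDl ltW.
exists c => //=; rewrite /diffquot E opprB addrCA subrr addr0 mulfK//.
by rewrite gt_eqF.
Qed.

Lemma boxspline_cauchy1 q k x :
  `|boxspline (q + k).+2 k.+2 x - boxspline (q + k).+1 k.+1 x| <= Q q.+1 * b (q + k).+1.
Proof.
have [y /andP[y1 y2] ->] := boxspline_step (q + k).+1 k x.
rewrite -addSn; apply: le_trans (boxspline_lip _ _ _ _) _.
by rewrite ler_wpM2l ?Q_ge0// distrC ger0_norm; lra.
Qed.

(** The shifts [b n] telescope to differences of [t], which makes the sequence for each order [q]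
    uniformly Cauchy. *)
Lemma boxspline_cauchy q k i x :
  `|boxspline (q + (k + i)).+1 (k + i).+1 x - boxspline (q + k).+1 k.+1 x| <=
  Q q.+1 * (t (q + k).+1 - t (q + (k + i)).+1).
Proof.
elim: i => [|i IH]; first by rewrite addn0 !subrr normr0 mulr0.
rewrite addnS (_ : _ - _ =
    (boxspline (q + (k + i)).+2 (k + i).+2 x - boxspline (q + (k + i)).+1 (k + i).+1 x) +
    (boxspline (q + (k + i)).+1 (k + i).+1 x - boxspline (q + k).+1 k.+1 x)); last first.
  by rewrite addrA subrK addnS.
apply: le_trans (ler_normD _ _) _; apply: le_trans (lerD (boxspline_cauchy1 _ _ _) IH) _.
by rewrite -mulrDr ler_wpM2l ?Q_ge0// /b addnS; lra.
Qed.

Lemma boxspline_eq0 n p x : x <= 0 -> boxspline n p.+1 x = 0.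
Proof.
elim: n x => [|n IH] x x0 /=; first by rewrite /truncpow max_r// exprS !mul0r.
by rewrite /diffquot !IH ?subrr ?mul0r//; have := b_gt0 n; lra.
Qed.

Lemma boxspline_eq1 n x : t 0%N - t n.+1 <= x -> boxspline n.+1 n.+1 x = 1.
Proof.
elim: n x => [|n IH] x xt.
  rewrite /= /diffquot /truncpow !expr1 !divr1 !max_l;
    [|rewrite /b; lra|by have := b_gt0 0%N; rewrite /b; lra].
  by rewrite opprB addrCA subrr addr0 divff// gt_eqF.
have [y /andP[y1 _] ->] := boxspline_step n.+1 n x.
by apply: IH; move: y1 xt; rewrite /b; lra.
Qed.

Let t_shift k : (fun n => t (n + k)%N) @ \oo --> (0 : R).
Proof. by have := cvg_comp _ _ (cvg_addnr k) tlim. Qed.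

(** The primitive of the infinite convolution of the uniform densities on [[0, b j]], whose total
    width is [t 0]; [d q] is the limit of the [q]-th derivatives of the finite convolutions. *)
Lemma smooth_step : exists d : nat -> R -> R,
  [/\ jet (V := R) d, forall x, x <= 0 -> d 0%N x = 0,
      forall x, t 0%N <= x -> d 0%N x = 1 & forall q x, `|d q x| <= Q q].
Proof.
have lim1 q x : exists l : R, (fun n => boxspline (q + n).+1 n.+1 x) @ \oo --> l.
  apply: (@real_cauchy_lim _ _ (fun n => Q q.+1 * t (n + q.+1)%N)).
    by rewrite -[X in _ --> X](mulr0 (Q q.+1)); apply: cvgM (t_shift _); exact: cvg_cst.
  move=> n m /subnKC <-; apply: le_trans (boxspline_cauchy _ _ _ _) _.
  by rewrite ler_wpM2l ?Q_ge0// addnS [(n + q)%N]addnC; have := tge0 (q + (n + (m - n))).+1; lra.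
have /choice[d0 H0] : forall qx : nat * R, exists l : R,
    (fun n => boxspline (qx.1 + n).+1 n.+1 qx.2) @ \oo --> l.
  by move=> [q x]; exact: lim1.
pose d q x := d0 (q, x).
have Hd q x : (fun n => boxspline (q + n).+1 n.+1 x) @ \oo --> d q x by exact: (H0 (q, x)).
have bnd q k x : `|boxspline (q + k).+1 k.+1 x - d q x| <= Q q.+1 * t (q + k).+1.
  have cw : (fun m => `|boxspline (q + k).+1 k.+1 x - boxspline (q + m).+1 m.+1 x|) @ \oo -->
      `|boxspline (q + k).+1 k.+1 x - d q x|.
    by apply: cvg_norm; apply: cvgB => //; exact: cvg_cst.
  rewrite -(cvg_lim _ cw)//; apply: limr_le; first by apply/cvg_ex; eexists; exact: cw.
  exists k => // m /= km; rewrite distrC -(subnKC km).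
  apply: le_trans (boxspline_cauchy _ _ _ _) _.
  by rewrite ler_wpM2l ?Q_ge0//; have := tge0 (q + (k + (m - k))).+1; lra.
exists d; split.
(* Differentiation lowers the second index alone, so the sequence for [d q] is taken one step later
   than the one for [d q.+1]. *)
- move=> q; apply: (@real_is_derive_lim _ (fun n => boxspline (q + n).+2 n.+2)
    (fun n => boxspline (q.+1 + n).+1 n.+1) _ _ 0%N).
  + by move=> n x _; rewrite addSn; exact: boxspline_is_derive.
  + move=> x; have /cvg_comp := cvg_addnr 1 => /(_ _ _ _ (Hd q x)).
    rewrite (_ : _ \o _ = (fun n => boxspline (q + n).+2 n.+2 x))//.
    by apply/funext => n; rewrite /= addn1 addnS.
  + move=> e e0; have e1 : 0 < e / (Q q.+2 + 1) by rewrite divr_gt0// ltr_pwDr// Q_ge0.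
    have /cvgrPdist_lt /(_ _ e1) [N _ HN] := t_shift q.+2.
    exists N => n x Nn; apply: le_trans (bnd _ _ _) _.
    have := HN n Nn; rewrite sub0r normrN ger0_norm// addnC addSn -addSn => h.
    apply: le_trans (_ : Q q.+2 * (e / (Q q.+2 + 1)) <= _).
      by rewrite ler_wpM2l ?Q_ge0// ltW.
    have Q2 := Q_ge0 q.+2.
    by rewrite mulrA ler_pdivrMr ?ltr_pwDr//; nra.
- move=> x x0; have := Hd 0%N x.
  rewrite (_ : (fun n => _) = cst 0); last by apply/funext => n; rewrite boxspline_eq0.
  by move/cvg_lim => <-//; rewrite lim_cst.
- move=> x x0; have := Hd 0%N x.
  rewrite (_ : (fun n => _) = cst 1); last first.
    by apply/funext => n; rewrite boxspline_eq1//; have := tge0 (0 + n).+1; lra.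
  by move/cvg_lim => <-//; rewrite lim_cst.
- move=> q x.
  have cw : (fun n => `|boxspline (q + n).+1 n.+1 x|) @ \oo --> `|d q x|.
    by apply: cvg_norm; exact: Hd.
  rewrite -(cvg_lim _ cw)//; apply: limr_le; first by apply/cvg_ex; eexists; exact: cw.
  by near=> n; exact: boxspline_bound.
Unshelve. all: by end_near. Qed.

End smooth_step.

(** * Weight sequences and cutoffs *)

Section weights.
Variables (R : realType) (M : nat -> R).
Hypothesis WM : weight_sequence M.

Lemma weight_gt0 p : 0 < M p. Proof. by case: WM. Qed.

Lemma weight_ratio_le p q : M p.+1 / M p <= M (p + q).+1 / M (p + q)%N.
Proof.
elim: q => [|q IH]; first by rewrite addn0.
apply: le_trans IH _; rewrite addnS.
have [_ + _ _] := WM => /(_ (p + q).+1 isT) /= h.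
rewrite ler_pdivrMr ?weight_gt0// mulrAC ler_pdivlMr ?weight_gt0//.
by rewrite -expr2 mulrC.
Qed.

(** By log-convexity the ratios [M p.+1 / M p] increase; [M p / M 0] is a product of [p] ratios,
    each at most the matching ratio in [M (p + q) / M q]. *)
Lemma weightM p q : M p * M q <= M 0%N * M (p + q)%N.
Proof.
elim: p => [|p IH]; first by rewrite add0n.
have := weight_ratio_le p q; rewrite ler_pdivrMr ?weight_gt0// => h.
apply: le_trans (_ : M (p + q).+1 / M (p + q)%N * M p * M q <= _).
  by rewrite ler_wpM2r// ltW// weight_gt0.
rewrite -mulrA; apply: le_trans (ler_wpM2l _ IH) _.
  by rewrite divr_ge0// ltW// weight_gt0.
by rewrite mulrCA divfK// gt_eqF// weight_gt0.
Qed.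

Lemma weight_summable : exists S : R, forall n, \sum_(0 <= q < n) M q / M q.+1 <= S.
Proof.
have [_ _ _ [A A0 /(_ 1%N isT) H]] := WM.
set K := A * _ * _ / _ in H.
have H2 n : \sum_(2 <= q < n) M q.-1 / M q <= K.
  rewrite -lee_fin; apply: le_trans H; rewrite -sumEFin.
  have := @nneseries_lim_ge R (fun q => (M q.-1 / M q)%:E) xpredT 2 n; apply => q _ _.
  by rewrite lee_fin divr_ge0// ltW// weight_gt0.
(* At [p = 1] the series of (M.3) starts with [M 1 / M 2]; the term [M 0 / M 1] is added
   separately. *)
exists (M 0%N / M 1%N + K) => -[|n].
  have := H2 0%N; rewrite !big_geq// => K0.
  by rewrite addr_ge0// divr_ge0// ltW// weight_gt0.
rewrite big_nat_recl// lerD2l.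
by have := H2 n.+2; rewrite big_add1/= big_add1/=.
Qed.

(* The witness [t n] is the square root of [\sum_(q >= n) M q / M q.+1]. *)
Lemma weight_root : exists t : nat -> R,
  [/\ forall n, t n.+1 < t n, forall n, 0 <= t n, t @ \oo --> (0 : R) &
      forall n, 2 / (t n - t n.+1) <= 4 * t n * (M n.+1 / M n)].
Proof.
have [S HS] := weight_summable.
pose s n := \sum_(0 <= q < n) M q / M q.+1.
have sS n : s n.+1 = s n + M n / M n.+1 by rewrite /s big_nat_recr.
have apos n : 0 < M n / M n.+1 by rewrite divr_gt0// weight_gt0.
have snd : nondecreasing_seq s.
  by apply/nondecreasing_seqP => n; rewrite sS lerDl ltW.
have sc : cvgn s.
  by apply: nondecreasing_is_cvgn => //; exists S => _ [n _ <-]; exact: HS.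
pose T n := limn s - s n.
have Tpos n : 0 < T n.
  rewrite subr_gt0; apply: lt_le_trans (_ : s n.+1 <= _); first by rewrite sS ltrDl.
  exact: nondecreasing_cvgn_le.
have TS n : T n - T n.+1 = M n / M n.+1 by rewrite /T sS; ring.
pose t n := Num.sqrt (T n).
have tpos n : 0 < t n by rewrite sqrtr_gt0.
have tT n : t n ^+ 2 = T n by rewrite sqr_sqrtr// ltW.
have tdec n : t n.+1 < t n by rewrite ltr_sqrt// -subr_gt0 TS.
exists t; split => //.
- by move=> n; exact: ltW.
- rewrite -(@sqrtr0 R); apply: continuous_cvg; first exact: sqrt_continuous.
  by rewrite -[X in _ --> X](subrr (limn s)); apply: cvgB => //; exact: cvg_cst.
(* Factoring the difference of squares gives [t n - t n.+1] as [M n / M n.+1] over [t n + t n.+1].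
   The factor [t n] gained in this way tends to 0, and this yields derivative bounds for every
   [h > 0]. *)
- move=> n; have := TS n; rewrite -!tT subr_sqr => E.
  have d0 : 0 < t n - t n.+1 by rewrite subr_gt0.
  rewrite -[M n.+1 / M n]invf_div -E ler_pdivrMr// invfM.
  rewrite [leRHS](_ : _ = 4 * t n / (t n + t n.+1)); last first.
    by field; rewrite !gt_eqF// addr_gt0.
  by rewrite ler_pdivlMr ?addr_gt0//; have := tdec n; lra.
Qed.

Lemma cutoff_exists : exists d : nat -> R -> R,
  [/\ jet (V := R) d, forall x, `|x| <= 1 -> d 0%N x = 1,
      forall x, 2 <= `|x| -> d 0%N x = 0 &
      forall h, 0 < h -> exists2 C, 0 <= C & forall m x, `|d m x| <= C * (h ^+ m * M m)].
Proof.
have [t [tdec tge0 tlim tM]] := weight_root.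
have [s [js s0 s1 sQ]] := smooth_step tdec tge0 tlim.
pose Q q := \prod_(j < q) (2 / (t j - t j.+1)).
have Qge0 q : 0 <= Q q.
  by apply: prodr_ge0 => j _; rewrite divr_ge0// subr_ge0 ltW.
have Qb h : 0 < h -> exists2 C, 0 <= C & forall m, Q m <= C * (h ^+ m * M m).
  move=> h0.
  have h4 : 0 < h / 4 by lra.
  have /cvgrPdist_lt /(_ _ h4) [N _ HN] := tlim.
  pose e m := Q m / (h ^+ m * M m).
  have hM m : 0 < h ^+ m * M m by rewrite mulr_gt0 ?exprn_gt0 ?weight_gt0.
  have e0 m : 0 <= e m by rewrite divr_ge0// ltW.
  (* Once [t n < h / 4], the successive ratios of [e] are at most 1, so [e] is bounded by its first
     [N.+1] values, hence by their sum. *)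
  exists (\sum_(j < N.+1) e j); first exact: sumr_ge0.
  move=> m; rewrite -ler_pdivrMr// -/(e m).
  have small i : (i <= N)%N -> e i <= \sum_(j < N.+1) e j.
    move=> iN; rewrite -ltnS in iN; rewrite (bigD1 (Ordinal iN))//= lerDl.
    by rewrite sumr_ge0.
  have [/small//|Nm] := leqP m N.
  rewrite -(subnKC (ltnW Nm)); elim: (m - N)%N => [|i IH]; first by rewrite addn0 small.
  apply: le_trans IH; rewrite addnS /e ler_pdivrMr// {1}/Q big_ord_recr/= -/(Q _).
  have := HN (N + i)%N (leq_addr _ _); rewrite /= sub0r normrN ger0_norm// => tn.
  have := tM (N + i)%N; have := weight_gt0 (N + i).
  have hM' := hM (N + i)%N.
  have := weight_gt0 (N + i).+1.
  move: (2 / (t _ - _)) => c M1 M0 hc.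
  have hc2 : c <= h * (M (N + i).+1 / M (N + i)%N).
    by apply: le_trans hc _; rewrite ler_wpM2r ?divr_ge0 ?ltW//; lra.
  apply: le_trans (ler_wpM2l (Qge0 _) hc2) _.
  rewrite le_eqVlt; apply/orP; left; apply/eqP; rewrite exprS; field.
  by rewrite !gt_eqF ?exprn_gt0.
have W0 : 0 < t 0%N by exact: le_lt_trans (tge0 1%N) (tdec 0%N).
set W := t 0%N in W0 s1.
(* The step rises over [[0, W]]; rescaled, the first copy rises on [[-2, -1]] and the second one
   cancels it on [[1, 2]]. *)
pose d m x := W ^+ m * (s m (W * x + 2 * W) - s m (W * x + - W)).
exists d; split.
- move=> m x.
  have h1 := is_derive_affine (js m (W * x + 2 * W)).
  have h2 := is_derive_affine (js m (W * x + - W)).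
  have H := is_deriveZ (W ^+ m) (is_deriveB h1 h2).
  by apply: is_derive_eq H _; rewrite /d /GRing.scale/= exprS; ring.
- move=> x; rewrite ler_norml => /andP[x1 x2]; rewrite /d expr0 mul1r.
  by rewrite s1 ?s0 ?subr0//; nra.
- move=> x; rewrite ler_normr => /orP[x2|x2]; rewrite /d expr0 mul1r.
    by rewrite s1 ?s1 ?subrr//; nra.
  by rewrite s0 ?s0 ?subrr//; nra.
- move=> h h0; have [C C0 HC] := Qb (h / W) (divr_gt0 h0 W0).
  exists (2 * C); first by rewrite mulr_ge0.
  move=> m x; have := HC m; rewrite expr_div_n => Hm.
  have Wm : 0 < W ^+ m by rewrite exprn_gt0.
  rewrite /d normrM (gtr0_norm Wm).
  apply: le_trans (_ : W ^+ m * (Q m + Q m) <= _).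
    by rewrite ler_pM2l//; apply: le_trans (ler_normB _ _) _; exact: lerD.
  apply: le_trans (_ : W ^+ m * (2 * (C * (h ^+ m / W ^+ m * M m))) <= _).
    by rewrite ler_pM2l//; lra.
  by rewrite le_eqVlt; apply/orP; left; apply/eqP; field; rewrite gt_eqF.
Qed.

End weights.

(** * Classes of test functions and uniform boundedness *)

Section test_functions.
Variables (R : realType) (M : nat -> R).
Hypothesis M_gt0 : forall p, 0 < M p.
Notation C := (Rcomplex R).
Notation fct := (R -> C).
Implicit Types (z : C) (phi psi : fct) (T : fct -> C) (a h r c : R).

Lemma jet_lin (d d' : nat -> R -> C) (z : C) : jet d -> jet d' ->
  jet (fun m x => z * d m x + d' m x).
Proof.
move=> jd jd' m x; have h := is_derive_mulC z (jd m x).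
exact: is_deriveD h (jd' m x).
Qed.

Lemma smooth_lin z phi psi : smooth phi -> smooth psi ->
  smooth (fun x => z * phi x + psi x).
Proof. by move=> /smooth_jet s1 /smooth_jet s2; exact: jet_smooth (jet_lin z s1 s2). Qed.

Lemma derive1n_lin m z phi psi : smooth phi -> smooth psi ->
  derive1n m (fun x => z * phi x + psi x) =
  (fun x => z * derive1n m phi x + derive1n m psi x).
Proof. by move=> /smooth_jet s1 /smooth_jet s2; exact: jet_derive1n m (jet_lin z s1 s2). Qed.

Lemma smooth_dilate s phi : smooth phi -> smooth (fun x => phi (s * x)).
Proof.
move=> /smooth_jet /(jet_dilate s) /jet_smooth.
by rewrite (_ : (fun x => _) = (fun x => phi (s * x)))//; apply/funext => x; rewrite expr0 scale1r.
Qed.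

Lemma derive1n_dilate m s phi : smooth phi ->
  derive1n m (fun x => phi (s * x)) = (fun x => s ^+ m *: derive1n m phi (s * x)).
Proof.
move=> /smooth_jet /(jet_dilate s) /(jet_derive1n m) <-.
by congr derive1n; apply/funext => x; rewrite expr0 scale1r.
Qed.

Lemma smooth0 : smooth (fun _ => 0 : C).
Proof.
have : jet (fun (_ : nat) (_ : R) => 0 : C) by move=> m x; exact: is_derive_cst.
exact: jet_smooth.
Qed.

Lemma derive1n_fun0 m : derive1n m (fun _ : R => 0 : C) = (fun _ => 0).
Proof.
have : jet (fun (_ : nat) (_ : R) => 0 : C) by move=> k x; exact: is_derive_cst.
by move/(jet_derive1n m).
Qed.

Lemma derive1n_eq0 m phi r : (forall x, `|x| < r -> phi x = 0) ->
  forall x, `|x| < r -> derive1n m phi x = 0.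
Proof.
move=> p0; elim: m => [|m IH] x xr; first exact: p0.
rewrite derive1nS derive1E (@near_eq_derive _ _ _ _ (cst 0)) ?derive_cst//.
have o : open [set y : R | `|y| < r].
  apply: (@open_comp _ _ (fun y : R => `|y|) [set y | y < r]) => //.
  by move=> y _; exact: norm_continuous.
by apply: filterS (open_nbhs_nbhs (conj o xr)) => y; exact: IH.
Qed.

Lemma weight_scale_ge0 h m : 0 <= h -> 0 <= h ^+ m * M m.
Proof. by move=> h0; rewrite mulr_ge0 ?exprn_ge0// ltW. Qed.

Lemma weight_scale_le h h' m : 0 <= h -> h <= h' -> h ^+ m * M m <= h' ^+ m * M m.
Proof.
move=> h0 hh; rewrite ler_wpM2r ?(ltW (M_gt0 _))// lerXn2r ?nnegrE//.
exact: le_trans h0 hh.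
Qed.

Lemma norm_le_normD z (w : C) : `|z| <= `|z + w| + `|w|.
Proof. by rewrite -{1}(addrK w z); exact: ler_normB. Qed.

Definition dbound h c phi := forall m x, `|derive1n m phi x| <= c * (h ^+ m * M m).

(** Asking for bounds at every [h > a] makes this a Fréchet space, so that nested balls can be used
    in the Roumieu case as well. *)
Definition testclass a r phi :=
  [/\ smooth phi, forall x, r < `|x| -> phi x = 0 &
      forall h, a < h -> exists c, dbound h c phi].

Definition linear_on (P : fct -> Prop) T := forall (z : C) phi psi, P phi -> P psi ->
  T (fun x => z * phi x + psi x) = z * T phi + T psi.

Lemma linear_on0 (P : fct -> Prop) T : P (fun _ => 0) -> linear_on P T -> T (fun _ => 0) = 0.
Proof.
move=> P0 /(_ 1 _ _ P0 P0) /eqP; under eq_fun do rewrite mulr0 addr0.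
by rewrite mul1r addrC -subr_eq subrr => /eqP <-.
Qed.

Lemma dbound_ge0 h c phi : dbound h c phi -> 0 <= c.
Proof.
move=> /(_ 0%N 0); rewrite expr0 mul1r => H.
by have := le_trans (normr_ge0 _) H; rewrite pmulr_lge0.
Qed.

Lemma dbound_le h h' c c' phi : 0 <= h -> h <= h' -> c <= c' ->
  dbound h c phi -> dbound h' c' phi.
Proof.
move=> h0 hh cc db m x; have c0 := dbound_ge0 db; apply: le_trans (db m x) _.
by apply: ler_pM => //; [exact: weight_scale_ge0|exact: weight_scale_le].
Qed.

Lemma dbound_lin h c c' z phi psi : smooth phi -> smooth psi ->
  dbound h c phi -> dbound h c' psi ->
  dbound h (`|z| * c + c') (fun x => z * phi x + psi x).
Proof.
move=> s1 s2 b1 b2 m x; rewrite derive1n_lin//.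
apply: le_trans (ler_normD _ _) _; rewrite mulrDl lerD// Rcomplex_normM -mulrA.
by rewrite ler_wpM2l.
Qed.

Lemma testclass_lin a r z phi psi : testclass a r phi -> testclass a r psi ->
  testclass a r (fun x => z * phi x + psi x).
Proof.
move=> [s1 o1 b1] [s2 o2 b2]; split; first exact: smooth_lin.
- by move=> x rx; rewrite o1// o2// mulr0 addr0.
- by move=> h ah; have [c1 ?] := b1 h ah; have [c2 ?] := b2 h ah;
    exists (`|z| * c1 + c2); exact: dbound_lin.
Qed.

Lemma dbound0 h c : 0 <= h -> 0 <= c -> dbound h c (fun _ => 0).
Proof.
by move=> h0 c0 m x; rewrite derive1n_fun0 normr0 mulr_ge0// weight_scale_ge0.
Qed.

Lemma testclass0 a r : 0 <= a -> testclass a r (fun _ => 0).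
Proof.
move=> a0; split => //; first exact: smooth0.
by move=> h ah; exists 0; apply: dbound0 => //; rewrite (le_trans a0)// ltW.
Qed.

(** The difference is written in the shape [z * phi x + psi x], in which linearity is stated
    throughout. *)
Definition sub_fct phi psi : fct := fun x => -1 * psi x + phi x.

Lemma sub_fctK phi psi : (fun x => 1 * sub_fct phi psi x + psi x) = phi.
Proof. by apply/funext => x; rewrite /sub_fct mul1r mulN1r addrAC addNr add0r. Qed.

Lemma derive1n_sub m phi psi x : smooth phi -> smooth psi ->
  derive1n m (sub_fct phi psi) x = derive1n m phi x - derive1n m psi x.
Proof. by move=> s1 s2; rewrite derive1n_lin// mulN1r addrC. Qed.

Lemma dbound_subP h c phi psi : smooth phi -> smooth psi ->
  dbound h c (sub_fct phi psi) <->
  forall m x, `|derive1n m phi x - derive1n m psi x| <= c * (h ^+ m * M m).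
Proof.
by move=> s1 s2; split => H m x; have := H m x; rewrite derive1n_sub.
Qed.

Lemma dbound_dist h c c' phi1 phi2 phi3 : smooth phi1 -> smooth phi2 -> smooth phi3 ->
  dbound h c (sub_fct phi1 phi2) -> dbound h c' (sub_fct phi2 phi3) ->
  dbound h (c + c') (sub_fct phi1 phi3).
Proof.
move=> s1 s2 s3 /dbound_subP h1 /dbound_subP h2; apply/dbound_subP => // m x.
rewrite mulrDl; apply: le_trans (ler_distD (derive1n m phi2 x) _ _) _.
by rewrite lerD ?h1 ?h2.
Qed.

(** All derivatives converge uniformly, so the limit is smooth. It stays in the class because for
    each [k > a] some [h n] is below [k], and the limit is [s n] plus a remainder bounded at that
    [h n]. *)
Lemma test_complete a r (s : nat -> fct) (h e : nat -> R) : 0 <= a ->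
  (forall n, testclass a r (s n)) ->
  (forall n, 0 <= h n) -> (forall n, h n.+1 <= h n) ->
  (forall k, a < k -> exists n, h n <= k) -> (forall n, e n <= 2^-1 ^+ n) ->
  (forall n k, dbound (h n) (e n) (sub_fct (s (n + k)%N) (s n))) ->
  exists2 phi, testclass a r phi & forall n, dbound (h n) (e n) (sub_fct phi (s n)).
Proof.
move=> a0 ts h0 hS hk e2 H.
have ss n : smooth (s n) by case: (ts n).
have hh n : h n <= h 0%N by elim: n => // n IH; exact: le_trans (hS n) IH.
have e0 n : 0 <= e n by exact: dbound_ge0 (H n 0%N).
have eM m : (fun n => e n * (h n ^+ m * M m)) @ \oo --> (0 : R).
  apply: (@squeeze_cvgr _ _ _ _ (fun _ => 0) (fun n => 2^-1 ^+ n * (h 0%N ^+ m * M m))).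
  - near=> n; rewrite mulr_ge0 ?weight_scale_ge0//=.
    by rewrite ler_pM// ?weight_scale_ge0// weight_scale_le.
  - exact: cvg_cst.
  - rewrite -[X in _ --> X](mul0r (h 0%N ^+ m * M m)); apply: cvgM; last exact: cvg_cst.
    by apply: cvg_expr; rewrite ger0_norm; lra.
have ex (mx : nat * R) : exists l : C,
    ((fun n => derive1n mx.1 (s n) mx.2) @ \oo --> l) /\
    forall n, `|l - derive1n mx.1 (s n) mx.2| <= e n * (h n ^+ mx.1 * M mx.1).
  case: mx => m x; apply: cauchy_lim (eM m) _ => n n' /subnKC <-.
  by have /dbound_subP := H n (n' - n)%N; apply.
have [l Hl] := choice ex.
pose d m x := l (m, x).
have dl m x : (fun n => derive1n m (s n) x) @ \oo --> d m x by case: (Hl (m, x)).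
have db m x n : `|d m x - derive1n m (s n) x| <= e n * (h n ^+ m * M m).
  by case: (Hl (m, x)).
have jd : jet d.
  move=> m; apply: (@complex_is_derive_lim _ (fun n => derive1n m (s n))
    (fun n => derive1n m.+1 (s n))).
  - by move=> n x; exact: smooth_jet.
  - exact: dl.
  - move=> eps eps0; have /cvgrPdist_lt /(_ _ eps0) [N _ HN] := eM m.+1.
    exists N => n x Nn; rewrite distrC; apply: le_trans (db _ _ _) _.
    by have := HN n Nn; rewrite /= sub0r normrN => /(le_lt_trans (ler_norm _))/ltW.
have dE m : derive1n m (d 0%N) = d m by exact: jet_derive1n.
have sd : smooth (d 0%N) by exact: jet_smooth jd.
have conv n : dbound (h n) (e n) (sub_fct (d 0%N) (s n)).
  by apply/dbound_subP => // m x; rewrite dE.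
exists (d 0%N) => //; split => //.
- move=> x rx; have := dl 0%N x.
  rewrite (_ : (fun n => _) = cst 0); last first.
    by apply/funext => n; case: (ts n) => _ + _; apply.
  by move/cvg_lim => <-//; rewrite lim_cst.
- move=> k /[dup] ak /hk [n hn]; have [_ _ /(_ _ ak)[c Hc]] := ts n.
  exists (`|1 : C| * e n + c); rewrite -(sub_fctK (d 0%N) (s n)).
  apply: dbound_lin => //; first exact: smooth_lin.
  by apply: dbound_le (conv n).
Unshelve. all: by end_near. Qed.

(* Banach-Steinhaus for functionals that are only eventually bounded at each
   point, by nested balls [dbound h rho (sub_fct _ s)]. *)
Lemma uniform_boundedness a r (T : R -> fct -> C) : 0 <= a ->
  (forall l, 1 <= l -> linear_on (testclass a r) (T l)) ->
  (forall l, 1 <= l -> exists h c, a < h /\ forall phi b, testclass a r phi ->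
     dbound h b phi -> `|T l phi| <= c * b) ->
  (forall phi, testclass a r phi -> exists B l0, forall l, l0 <= l -> `|T l phi| <= B) ->
  exists h c l0, [/\ a < h, 1 <= l0, 0 <= c & forall l phi b, l0 <= l ->
     testclass a r phi -> dbound h b phi -> `|T l phi| <= c * b].
Proof.
move=> a0 Tlin Tcont Tpt; apply: contrapT => noB.
have bad h c l0 : a < h -> 1 <= l0 -> 0 <= c -> exists l phi b,
    [/\ l0 <= l, testclass a r phi, dbound h b phi & c * b < `|T l phi|].
  move=> ah l1 c0; apply: contrapT => H; apply: noB; exists h, c, l0; split => //.
  move=> l phi b ll tp db; rewrite leNgt; apply/negP => lt; apply: H.
  by exists l, phi, b.
(* A state is a ball: its centre, the index of its seminorm and its radius. Step [n] finds a smaller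
   ball on all of which some [T l] with [l >= n] has modulus at least [n]. *)
pose valid (st : fct * (R * R)) := [/\ testclass a r st.1, a < st.2.1 & 0 < st.2.2].
pose step n (st st' : fct * (R * R)) :=
  [/\ st'.2.1 <= Num.min st.2.1 (a + n.+1%:R^-1), st'.2.2 <= st.2.2 / 2,
      dbound st.2.1 (st.2.2 / 2) (sub_fct st'.1 st.1) &
      exists l, [/\ n%:R <= l, 1 <= l & forall phi, testclass a r phi ->
        dbound st'.2.1 st'.2.2 (sub_fct phi st'.1) -> n%:R <= `|T l phi|]].
have ex (p : nat * (fct * (R * R))) : exists st', valid p.2 -> valid st' /\ step p.1 p.2 st'.
  case: p => n [s [h rho]] /=.
  have [[/= ts ah rho0]|nv] := pselect (valid (s, (h, rho))); last by exists (s, (h, rho)).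
  have [B [l0 HB]] := Tpt s ts.
  (* The target size at the new centre: [|B|] is lost to [T l s], and 1 to the variation of [T l]
     over the new ball. *)
  pose K := n%:R + 1 + `|B|.
  have K0 : 0 < K by rewrite ltr_pwDl// ltr_wpDl.
  have [l [phi [b [ll tphi db lt]]]] :
      exists l phi b, [/\ Num.max l0 (Num.max 1 n%:R) <= l, testclass a r phi,
      dbound h b phi & (2 * K / rho) * b < `|T l phi|].
    apply: bad => //; first by rewrite !le_max lexx orbT.
    by rewrite divr_ge0 ?mulr_ge0// ltW.
  move: ll; rewrite !ge_max => /and3P[ll0 l1 ln].
  have b0 := dbound_ge0 db.
  have T0 : 0 < `|T l phi|.
    by apply: le_lt_trans lt; rewrite mulr_ge0// divr_ge0 ?mulr_ge0// ltW.
  (* The multiple [t * phi] has [T l] of modulus exactly [K], while the choice of [phi] keeps it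
     within [rho / 2] of 0. *)
  pose t := K / `|T l phi|.
  have t0 : 0 < t by rewrite divr_gt0.
  pose s' : fct := fun x => (Complex t 0 : C) * phi x + s x.
  have ts' : testclass a r s' by exact: testclass_lin.
  have [h1 [c1 [ah1 Hc1]]] := Tcont l l1.
  (* Index and radius are small enough for continuity of this one [T l] to limit its variation to 1;
     the bound [a + n.+1%:R^-1] drives the indices to [a]. *)
  pose h' := Num.min h1 (Num.min h (a + n.+1%:R^-1)).
  pose rho' := Num.min (rho / 2) (`|c1| + 1)^-1.
  have rho'0 : 0 < rho' by rewrite lt_min divr_gt0// invr_gt0 ltr_pwDr.
  have ah' : a < h' by rewrite !lt_min ah1 ah ltrDl invr_gt0 ltr0Sn.
  have [sphi _ _] := tphi; have [ss _ _] := ts.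
  exists (s', (h', rho')) => _; split; first by split.
  split => /=; first by rewrite /h' ge_min lexx orbT.
  - by rewrite /rho' ge_min lexx.
  - apply/dbound_subP => //; first exact: smooth_lin.
    move=> m x; rewrite derive1n_lin// addrK Rcomplex_normM Rcomplex_normr.
    apply: le_trans (ler_wpM2l (normr_ge0 _) (db m x)) _.
    rewrite (gtr0_norm t0) [leLHS]mulrA; apply: ler_wpM2r.
      by apply: weight_scale_ge0; rewrite (le_trans a0)// ltW.
    rewrite /t mulrAC ler_pdivrMr//.
    move/ltW: lt; rewrite mulrAC ler_pdivrMr// => lt.
    by lra.
  - exists l; split => // th tth dth.
    rewrite -(sub_fctK th s') Tlin//; last exact: testclass_lin.
    rewrite mul1r.
    have e1 : `|T l (sub_fct th s')| <= 1.
      apply: le_trans (Hc1 _ rho' _ _) _; first exact: testclass_lin.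
        apply: dbound_le dth => //; first by rewrite (le_trans a0)// ltW.
        by rewrite /h' ge_min lexx.
      apply: le_trans (_ : `|c1| * (`|c1| + 1)^-1 <= _).
        apply: le_trans (ler_wpM2r (ltW rho'0) (ler_norm c1)) _.
        by rewrite ler_wpM2l// /rho' ge_min lexx orbT.
      by rewrite ler_pdivrMr ?ltr_pwDr// mul1r lerDl.
    have e2 : K <= `|T l s'| + `|B|.
      rewrite /s' Tlin//.
      have -> : K = `|((Complex t 0 : C) * T l phi : C)|.
        by rewrite Rcomplex_normM Rcomplex_normr gtr0_norm// divfK// gt_eqF.
      apply: le_trans (norm_le_normD _ (T l s)) _; apply: lerD => //.
      exact: le_trans (HB l ll0) (ler_norm _).
    have e3 : `|T l s'| <= `|T l (sub_fct th s') + T l s'| + `|T l (sub_fct th s')|.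
      by rewrite [X in `|X| + _]addrC; exact: norm_le_normD.
    by move: e1 e2 e3; rewrite /K; lra.
have [nxt Hnxt] := choice ex.
pose st := fix st n := if n is n'.+1 then nxt (n', st n') else ((fun _ => 0) : fct, (a + 1, 1)).
have vst n : valid (st n).
  elim: n => [|n IH]; last by case: (Hnxt (n, st n) IH).
  by split => //=; [exact: testclass0|rewrite ltrDl].
have Hst n : step n (st n) (st n.+1) by case: (Hnxt (n, st n) (vst n)).
pose s n := (st n).1; pose h n := (st n).2.1; pose e n := (st n).2.2.
have ss n : smooth (s n) by case: (vst n) => -[].
have h0 n : 0 <= h n by case: (vst n) => _ /ltW/(le_trans a0).
have hS n : h n.+1 <= h n by case: (Hst n); rewrite le_min => /andP[].
have eS n : e n.+1 <= e n / 2 by case: (Hst n).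
have e0 n : 0 < e n by case: (vst n).
have nest n k phi : smooth phi -> dbound (h (n + k)%N) (e (n + k)%N) (sub_fct phi (s (n + k)%N)) ->
    dbound (h n) (e n) (sub_fct phi (s n)).
  move=> sp; elim: k => [|k IH]; first by rewrite addn0.
  rewrite addnS => db; apply: IH; have [_ _ d2 _] := Hst (n + k)%N.
  rewrite [e _]splitr; apply: dbound_dist d2 => //; [exact: ss|exact: ss|].
  by apply: dbound_le db.
have [phi tphi dphi] : exists2 phi, testclass a r phi &
    forall n, dbound (h n) (e n) (sub_fct phi (s n)).
  apply: test_complete => //.
  - by move=> n; case: (vst n).
  - move=> k /ltr_add_invr[n /ltW hn]; exists n.+1; apply: le_trans hn.
    by case: (Hst n); rewrite le_min => /andP[].
  - elim=> [|n IH]; first by rewrite expr0.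
    by apply: le_trans (eS n) _; rewrite exprSr ler_wpM2r.
  - move=> n k; apply: (nest n k) => //; apply/dbound_subP => // m x.
    by rewrite subrr normr0 mulr_ge0 ?weight_scale_ge0// ltW.
have [B [l0 HB]] := Tpt _ tphi.
(* Beyond both the bound and the threshold of the limit function: the [l] found at stage [n]
   contradicts [HB]. *)
pose n := (Num.truncn (Num.max (B + 1) l0)).+1.
have : Num.max (B + 1) l0 < n%:R by exact: truncnS_gt.
rewrite gt_max => /andP[nB nl0].
have [_ _ _ [l [nl l1 Hl]]] := Hst n.
have := Hl _ tphi (dphi n.+1); have := HB l (le_trans (ltW nl0) nl).
by lra.
Qed.

End test_functions.

(** * Continuous functionals on the two spaces *)

Section spaces.
Variables (R : realType) (M : nat -> R) (k : ultra_kind).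
Hypothesis M_gt0 : forall p, 0 < M p.
Notation C := (Rcomplex R).
Notation fct := (R -> C).
Implicit Types (z : C) (phi psi : fct) (T : fct -> C) (a h r c : R).

Definition admissible a : Prop := match k with Beurling => a = 0 | Roumieu => 0 < a end.

Lemma admissible_ge0 a : admissible a -> 0 <= a.
Proof. by rewrite /admissible; case: k => [->|/ltW]. Qed.

Definition Zbound n h c phi := forall m x,
  (1 + `|x|) ^+ (n + m) * `|derive1n m phi x| <= c * (h ^+ m * M m).

Definition Zclass n a phi := smooth phi /\ forall h, a < h -> exists c, Zbound n h c phi.

Lemma Zbound_dbound n h c phi : Zbound n h c phi -> dbound M h c phi.
Proof.
move=> Zb m x; apply: le_trans (Zb m x); rewrite ler_peMl// exprn_ege1//.
by rewrite lerDl.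
Qed.

Lemma Zbound_ge0 n h c phi : Zbound n h c phi -> 0 <= c.
Proof. by move/Zbound_dbound/(dbound_ge0 M_gt0). Qed.

Lemma Zbound_le n h h' c c' phi : 0 <= h -> h <= h' -> c <= c' ->
  Zbound n h c phi -> Zbound n h' c' phi.
Proof.
move=> h0 hh cc Zb m x; have c0 := Zbound_ge0 Zb; apply: le_trans (Zb m x) _.
by apply: ler_pM => //; [exact: weight_scale_ge0|exact: weight_scale_le].
Qed.

Lemma Zbound_lin n h c c' z phi psi : smooth phi -> smooth psi ->
  Zbound n h c phi -> Zbound n h c' psi ->
  Zbound n h (`|z| * c + c') (fun x => z * phi x + psi x).
Proof.
move=> s1 s2 b1 b2 m x; rewrite derive1n_lin//.
have n0 : 0 <= (1 + `|x|) ^+ (n + m) by rewrite exprn_ge0// addr_ge0.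
apply: le_trans (ler_wpM2l n0 (ler_normD _ _)) _; rewrite mulrDr mulrDl lerD//.
by rewrite Rcomplex_normM mulrCA -mulrA ler_wpM2l.
Qed.

Lemma Zclass_lin n a z phi psi : Zclass n a phi -> Zclass n a psi ->
  Zclass n a (fun x => z * phi x + psi x).
Proof.
move=> [s1 b1] [s2 b2]; split; first exact: smooth_lin.
move=> h ah; have [c1 ?] := b1 h ah; have [c2 ?] := b2 h ah.
by exists (`|z| * c1 + c2); exact: Zbound_lin.
Qed.

Lemma Zbound0 n h c : 0 <= h -> 0 <= c -> Zbound n h c (fun _ => 0).
Proof.
by move=> h0 c0 m x; rewrite derive1n_fun0 normr0 mulr0 mulr_ge0// weight_scale_ge0.
Qed.

Lemma Zclass0 n a : 0 <= a -> Zclass n a (fun _ => 0).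
Proof.
move=> a0; split; first exact: smooth0.
by move=> h ah; exists 0; apply: Zbound0 => //; rewrite (le_trans a0)// ltW.
Qed.

Lemma Zclass_le n a a' phi : a <= a' -> Zclass n a phi -> Zclass n a' phi.
Proof. by move=> aa [s b]; split => // h /(le_lt_trans aa)/b. Qed.

Lemma ereal_sup_leP (I : Type) (D : set I) (F : I -> R) c :
  (ereal_sup [set (F i)%:E | i in D] <= c%:E)%E <-> forall i, D i -> F i <= c.
Proof.
split=> [H i Di|H].
  by rewrite -lee_fin; apply: le_trans H; apply: ereal_sup_ubound; exists i.
by apply: ge_ereal_sup => _ [i Di <-]; rewrite lee_fin H.
Qed.

Lemma D_norm_le K h c phi : 0 < h -> dbound M h c phi -> (D_norm M K h phi <= c%:E)%E.
Proof.
move=> h0 db; apply/ereal_sup_leP => -[x m] _ /=.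
by rewrite ler_pdivrMr ?mulr_gt0 ?exprn_gt0.
Qed.

Lemma Z_norm_leP n h c phi : 0 < h -> (Z_norm M n h phi <= c%:E)%E <-> Zbound n h c phi.
Proof.
move=> h0; rewrite ereal_sup_leP; split => H.
  by move=> m x; have := H (x, m) I; rewrite /= ler_pdivrMr ?mulr_gt0 ?exprn_gt0.
by move=> [x m] _; rewrite ler_pdivrMr ?mulr_gt0 ?exprn_gt0//=; exact: H.
Qed.

Lemma ereal_lty_le (e : \bar R) : (e < +oo)%E -> exists c, (e <= c%:E)%E.
Proof. by case: e => [c|//|] _; [exists c|exists 0; rewrite leNye]. Qed.

Lemma itv_supp r phi : (forall x, r < `|x| -> phi x = 0) ->
  closure [set x | phi x != 0] `<=` `[- r, r].
Proof.
move=> H; have /closure_id -> : closed (`[- r, r] : set R) by exact: interval_closed.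
apply: closureS => x /=; apply: contraNP; rewrite in_itv /= -ler_norml => /negP.
by rewrite -ltNge => /H ->.
Qed.

Lemma D_carrier a r phi : admissible a -> testclass M a r phi -> carrier (D_space k M) phi.
Proof.
rewrite /admissible => aa [s o b]; exists (`[- r, r]%classic : set R); first exact: segment_compact.
have cl := itv_supp o.
case: k aa => [a0|a0].
  move=> h /= h0; split; first by split.
  have [|c Hc] := b h; first by rewrite a0.
  exact: le_lt_trans (D_norm_le _ h0 Hc) (ltry _).
have a1 : a < a + 1 by rewrite ltrDl.
exists (a + 1); first exact: lt_trans a1.
split; first by split.
have [c Hc] := b _ a1.
by apply: le_lt_trans (D_norm_le _ _ Hc) (ltry _); exact: lt_trans a1.
Qed.

Lemma D_supp phi : carrier (D_space k M) phi -> exists r, forall x, r < `|x| -> phi x = 0.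
Proof.
move=> [K cK H].
have cl : closure [set x | phi x != 0] `<=` K.
  by case: k H => [/(_ 1 ltr01)|[h h0]] [[]].
have [r [_ Hr]] := compact_bounded cK; exists (r + 1) => x rx.
apply: contrapT => /eqP px.
have /= := Hr (r + 1); rewrite ltrDl ltr01 => /(_ isT x) H2.
have /H2 : K x by apply/cl/subset_closure.
by rewrite leNgt rx.
Qed.

Lemma finite_set_min (I : Type) (J : set I) (P : I -> R -> Prop) :
  finite_set J -> (forall i e e', P i e -> 0 < e' -> e' <= e -> P i e') ->
  (forall i, J i -> exists2 e, 0 < e & P i e) ->
  exists2 e, 0 < e & forall i, J i -> P i e.
Proof.
elim/Pchoice: I => I in J P *.
move=> /finite_seqP[s ->] mono; elim: s => [|i s IH] H; first by exists 1.
have [j js|e e0 He] := IH; first by apply: H; rewrite /= inE; apply/orP; right.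
have [|e' e'0 He'] := H i; first by rewrite /= inE eqxx.
have m0 : 0 < Num.min e e' by rewrite lt_min e0.
exists (Num.min e e') => // j; rewrite /= inE => /orP[/eqP ->|js].
  by apply: mono He' _ _ => //; rewrite ge_min lexx orbT.
by apply: mono (He j js) _ _ => //; rewrite ge_min lexx.
Qed.

Lemma linear_onZ (P : fct -> Prop) T (t : R) phi : P (fun _ => 0) -> linear_on P T ->
  P phi -> T (fun x => (Complex t 0 : C) * phi x) = t *: T phi.
Proof.
move=> P0 Tl Pp; have := Tl (Complex t 0) _ _ Pp P0.
by rewrite (linear_on0 P0 Tl) addr0 -RcomplexZ => <-; congr T; apply/funext => x; rewrite addr0.
Qed.

Lemma D_dual_linear f a r : dual (D_space k M) f -> admissible a -> linear_on (testclass M a r) f.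
Proof.
move=> [fl _] aa z phi psi tp tq; by apply: fl; [exact: D_carrier aa tp|exact: D_carrier aa tq].
Qed.

(** A neighbourhood of 0 on which [|f| < 1] contains a ball of a single seminorm of the class, and
    homogeneity turns this into domination. *)
Lemma D_dual_bound f a r : dual (D_space k M) f -> admissible a ->
  exists h c, a < h /\ forall phi b, testclass M a r phi -> dbound M h b phi -> `|f phi| <= c * b.
Proof.
move=> df aa; have a0 := admissible_ge0 aa.
have fl := D_dual_linear (r := r) df aa.
have t0 : testclass M a r (fun _ => 0) by exact: testclass0.
have f0 := linear_on0 t0 fl.
have [_ /(_ _ (D_carrier aa t0))] := df.
move=> /(_ _ (nbhsx_ballx _ _ ltr01)) /= [V [_ /(_ `[- r, r]%classic)VK VU]].
have {VK} := VK (@segment_compact _ _ _).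
have {}VU phi : V phi -> `|f phi| < 1.
  move=> /VU /=; rewrite -ball_normE /= f0 sub0r normrN.
  by under eq_fun do rewrite add0r.
move=> VK.
have [h ah [e e0 He]] : exists2 h, a < h & exists2 e, 0 < e &
    forall phi b, testclass M a r phi -> dbound M h b phi -> b < e -> V phi.
  move: aa VK; rewrite /admissible; case: k => aa /=.
    move=> [J [W [fJ J0 HW WV]]].
    (* The finitely many conditions are merged into one number [e], used both as seminorm index and
       as radius; shrinking it weakens neither role. *)
    have [||e e0 He] := @finite_set_min _ J (fun i e => forall phi b, testclass M a r phi ->
        dbound M e b phi -> b < e -> W i phi) fJ.
    - move=> i e e' H e'0 e'e phi b tp db be; apply: (H _ b) => //.
        by apply: dbound_le db => //; exact: ltW.
      exact: lt_le_trans e'e.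
    - move=> i Ji; have := J0 i Ji => /= i0; have [e e0 He] := HW i Ji.
      exists (Num.min e i); first by rewrite lt_min e0.
      move=> phi b [s o tb] db; rewrite lt_min => /andP[be bi].
      have db' : dbound M i b phi.
        apply: dbound_le db => //; last by rewrite ge_min lexx orbT.
        by rewrite le_min !ltW.
      have Dn := D_norm_le `[- r, r]%classic i0 db'.
      apply: He; last by apply: le_lt_trans Dn _; rewrite lte_fin.
      split; last exact: le_lt_trans Dn (ltry _).
      by split => //; exact: itv_supp.
    subst a; exists e => //; exists e => // phi b tp db be; apply: WV; split.
      move=> i i0; have [s o tb] := tp; have [c Hc] := tb i i0.
      split; last exact: le_lt_trans (D_norm_le _ _ Hc) (ltry _).
      by split => //; exact: itv_supp.
    by move=> i Ji; exact: He Ji _ b tp db be.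
  have a1 : a < a + 1 by rewrite ltrDl.
  have a10 : 0 < a + 1 by exact: lt_trans a1.
  move=> [W [_ /(_ _ a10)[e e0 He] WV]]; exists (a + 1) => //; exists e => // phi b [s o tb] db be.
  have Dn := D_norm_le `[- r, r]%classic a10 db.
  apply/WV/He; last by apply: le_lt_trans Dn _; rewrite lte_fin.
  split; last exact: le_lt_trans Dn (ltry _).
  by split => //; exact: itv_supp.
exists h, (2 / e); split => // phi b tp db.
have b0 := dbound_ge0 M_gt0 db.
apply/ler_addgt0Pr => eps eps0.
(* The [eps] term keeps [d] positive when [b = 0]; scaling by [t] puts [phi] inside the ball, and
   [1 / t] equals [2 * b / e + eps]. *)
pose d := b + eps * e / 2.
have d0 : 0 < d by rewrite ltr_wpDl// divr_gt0// mulr_gt0.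
pose t := e / (2 * d).
have tt0 : 0 < t by rewrite divr_gt0// mulr_gt0.
have [sp _ _] := tp.
pose phi' : fct := fun x => (Complex t 0 : C) * phi x.
have phi'E : phi' = fun x => (Complex t 0 : C) * phi x + 0.
  by apply/funext => x; rewrite addr0.
have V' : V phi'.
  apply: (He _ (t * b + 0)).
  - rewrite phi'E; exact: testclass_lin tp t0.
  - rewrite phi'E -[t in t * b](gtr0_norm tt0) -Rcomplex_normr; apply: dbound_lin => //.
      exact: smooth0.
    by apply: dbound0 => //; rewrite (le_trans a0)// ltW.
  - rewrite addr0 /t mulrAC ltr_pdivrMr ?mulr_gt0// ltr_pM2l// /d.
    by have := mulr_gt0 eps0 e0; lra.
have := VU _ V'; rewrite (linear_onZ t t0 fl tp) normrZ gtr0_norm// /t.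
rewrite mulrAC ltr_pdivrMr ?mulr_gt0// mul1r => /ltW.
rewrite mulrC -ler_pdivlMr// => /le_trans; apply.
by rewrite /d le_eqVlt; apply/orP; left; apply/eqP; field; rewrite gt_eqF.
Qed.

Lemma Z_carrier n phi : carrier (Z_space k M) phi -> exists2 a, admissible a & Zclass n a phi.
Proof.
rewrite /admissible => /(_ n I); case: k => /=.
  move=> H; exists 0 => //; split; first by have [] := H 1 ltr01.
  move=> h h0; have [_ /ereal_lty_le[c Hc]] := H h h0.
  by exists c; apply/Z_norm_leP.
move=> [h /= h0 [s /ereal_lty_le[c Hc]]]; exists h => //; split => // h' hh'.
exists c; apply: Zbound_le ((Z_norm_leP n c phi h0).1 Hc) => //; exact: ltW.
Qed.

Lemma admissible_max a a' : admissible a -> admissible a' -> admissible (Num.max a a').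
Proof.
by rewrite /admissible; case: k => [-> ->|a0 a'0]; rewrite ?maxxx// lt_max a0.
Qed.

(** Domination at a single weight exponent [n] suffices, because the neighbourhoods of a projective
    limit may constrain just one index. *)
Lemma Z_dual n (F : fct -> C) : (forall a, admissible a -> linear_on (Zclass n a) F) ->
  (forall a, admissible a -> exists h c, a < h /\ forall phi b,
      Zclass n a phi -> Zbound n h b phi -> `|F phi| <= c * b) ->
  dual (Z_space k M) F.
Proof.
move=> Fl Fb; split.
  move=> z phi psi /(Z_carrier n)[a aa Za] /(Z_carrier n)[a' aa' Za'].
  apply: (Fl (Num.max a a')); first exact: admissible_max.
    by apply: Zclass_le Za; rewrite le_max lexx.
  by apply: Zclass_le Za'; rewrite le_max lexx orbT.
move=> phi /(Z_carrier n)[a aa Za]; move=> A; rewrite -nbhs_ballE => -[eps2 /= eps20 bA].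
pose eps := eps2 / 2; have eps0 : 0 < eps by rewrite divr_gt0.
exists [set n], (fun _ => [set psi |
  (exists2 a, admissible a & Zclass n a psi) /\ `|F psi| <= eps]).
split => //; last first.
  move=> psi [_ /(_ n erefl) /= [[a' aa' Za'] Fpsi]].
  apply: bA; rewrite -ball_normE /=; apply: (@le_lt_trans _ _ eps); last by rewrite /eps; lra.
  rewrite (_ : (fun x => _) = (fun x => 1 * phi x + psi x)); last first.
    by apply/funext => x; rewrite mul1r.
  have am := admissible_max aa aa'.
  rewrite (Fl _ am).
  - by rewrite mul1r opprD addrA subrr sub0r normrN.
  - by apply: Zclass_le Za; rewrite le_max lexx.
  - by apply: Zclass_le Za'; rewrite le_max lexx orbT.
move=> _ ->.
have key a' : admissible a' -> exists h e, [/\ a' < h, 0 < e & forall psi b,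
    Zclass n a' psi -> Zbound n h b psi -> b <= e -> `|F psi| <= eps].
  move=> aa'; have [h [c [ah Hc]]] := Fb a' aa'.
  have c1 : 0 < `|c| + 1 by rewrite ltr_pwDr.
  exists h, (eps / (`|c| + 1)); split => //; first exact: divr_gt0.
  move=> psi b Zp Zb be; apply: le_trans (Hc _ _ Zp Zb) _; have b0 := Zbound_ge0 Zb.
  apply: le_trans (_ : (`|c| + 1) * b <= _).
    by rewrite ler_wpM2r// (le_trans (ler_norm _))// lerDl.
  by rewrite mulrC -ler_pdivlMr.
move: key Fl; rewrite /admissible; case: k => key Fl /=.
  have [h [e [h0 e0 H]]] := key 0 erefl.
  exists [set h], (fun _ => [set psi | exists2 b, Zbound n h b psi & b <= e]); split => //.
  - by move=> _ -> /=.
  - move=> _ -> /=; exists e => // psi [sp fin] psie.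
    by exists e => //; apply/Z_norm_leP => //; exact: ltW.
  - move=> psi [car /(_ h erefl)/= [b Zb be]].
    have Zc : Zclass n 0 psi.
      split; first by have [] := car 1 ltr01.
      move=> h' h'0; have [_ /ereal_lty_le[c Hc]] := car h' h'0.
      by exists c; apply/Z_norm_leP.
    by split; [exists 0|exact: H Zc Zb be].
(* The sublevel set of [|F|] is itself absolutely convex: two of its elements lie in a common class,
   where [F] is linear. *)
exists [set psi | (exists2 a, 0 < a & Zclass n a psi) /\ `|F psi| <= eps]; split => //.
- split.
    exists (fun _ => 0); have Z0 : Zclass n 1 (fun _ => 0) by exact: Zclass0.
    split; first by exists 1.
    by rewrite (linear_on0 Z0 (Fl 1 ltr01)) normr0 ltW.
  move=> z w phi1 phi2 zw [[a1 a10 Z1] F1] [[a2 a20 Z2] F2].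
  have m0 : 0 < Num.max a1 a2 by rewrite lt_max a10.
  have {}Z1 : Zclass n (Num.max a1 a2) phi1 by apply: Zclass_le Z1; rewrite le_max lexx.
  have {}Z2 : Zclass n (Num.max a1 a2) phi2.
    by apply: Zclass_le Z2; rewrite le_max lexx orbT.
  have Z0 : Zclass n (Num.max a1 a2) (fun _ => 0) by apply: Zclass0; exact: ltW.
  have Z2' : Zclass n (Num.max a1 a2) (fun x => w * phi2 x).
    rewrite (_ : (fun x => _) = (fun x => w * phi2 x + 0)); first exact: Zclass_lin.
    by apply/funext => x; rewrite addr0.
  split; first by exists (Num.max a1 a2) => //; exact: Zclass_lin.
  rewrite (Fl _ m0)// (_ : (fun x => w * phi2 x) = (fun x => w * phi2 x + 0)); last first.
    by apply/funext => x; rewrite addr0.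
  rewrite (Fl _ m0)// (linear_on0 Z0 (Fl _ m0)) addr0.
  apply: le_trans (ler_normD _ _) _; rewrite !Rcomplex_normM.
  apply: le_trans (_ : `|z| * eps + `|w| * eps <= _).
    by rewrite lerD// ler_wpM2l.
  by rewrite -mulrDl ler_piMl// ltW.
- move=> h /= h0; have [h' [e [hh' e0 H]]] := key h h0.
  exists e => // psi [sp fin] psie.
  have Zb : Zbound n h e psi by apply/Z_norm_leP => //; exact: ltW.
  have Zc : Zclass n h psi.
    split => // h2 hh2; exists e; apply: Zbound_le Zb => //; exact: ltW.
  split; first by exists h.
  apply: (H _ e) => //; apply: Zbound_le Zb => //; exact: ltW.
Qed.

End spaces.

(** * Dyadic rings *)

Section cutoffs.
Variables (R : realType) (M : nat -> R).
Hypothesis M_gt0 : forall p, 0 < M p.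
Hypothesis MM : forall p q, M p * M q <= M 0%N * M (p + q)%N.
Variable dchi : nat -> R -> R.
Hypothesis chi_jet : jet (V := R) dchi.
Hypothesis chi1 : forall x, `|x| <= 1 -> dchi 0%N x = 1.
Hypothesis chi0 : forall x, 2 <= `|x| -> dchi 0%N x = 0.
Hypothesis chi_bound : forall h, 0 < h ->
  exists2 C, 0 <= C & forall m x, `|dchi m x| <= C * (h ^+ m * M m).
Notation C := (Rcomplex R).
Notation fct := (R -> C).
Implicit Types (z : C) (phi psi : fct) (T : fct -> C) (a h r c s : R).

Lemma smooth_prod (du : nat -> R -> R) phi : jet (V := R) du -> smooth phi ->
  smooth (fun x => du 0%N x *: phi x).
Proof. by move=> ju /smooth_jet /(prodjet_jet ju)/jet_smooth. Qed.

Lemma dbound_prod (du : nat -> R -> R) phi A B a b m x :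
  jet (V := R) du -> smooth phi -> 0 <= A -> 0 <= B -> 0 <= a -> 0 <= b ->
  (forall l, `|du l x| <= A * (a ^+ l * M l)) ->
  (forall l, `|derive1n l phi x| <= B * (b ^+ l * M l)) ->
  `|derive1n m (fun x => du 0%N x *: phi x) x| <= A * B * M 0%N * ((a + b) ^+ m * M m).
Proof.
move=> ju /smooth_jet sp A0 B0 a0 b0 hu hp.
rewrite (jet_derive1n m (prodjet_jet ju sp)).
have := @prodjet_bound R _ M du (fun m => derive1n m phi) A B a b x 0 0 m MM M_gt0 A0 B0 a0 b0.
rewrite !addn0; apply=> l; rewrite addn0; [exact: hu|exact: hp].
Qed.

Definition cutf s phi : fct := fun x => dchi 0%N (s * x) *: phi x.

Lemma cutf_lin s z phi psi : cutf s (fun x => z * phi x + psi x) =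
  (fun x => z * cutf s phi x + cutf s psi x).
Proof. by apply/funext => x; rewrite /cutf scalerDr !RcomplexZ mulrCA. Qed.

(** For one fixed cutoff, as [K] depends on [s]. The product rule gives the index [h + h], relaxed
    to the [3 * h] that the rings require. *)
Lemma cutf_bound s h : 0 < s -> 0 < h -> exists2 K, 0 <= K & forall phi b,
  smooth phi -> dbound M h b phi -> dbound M (3 * h) (K * b) (cutf s phi).
Proof.
move=> s0 h0; have [K K0 HK] := chi_bound (divr_gt0 h0 s0).
exists (K * M 0%N); first by rewrite mulr_ge0// ltW.
move=> phi b sp db; have b0 := dbound_ge0 M_gt0 db.
apply: (@dbound_le _ _ M_gt0 (h + h) _ (K * b * M 0%N)).
- by rewrite addr_ge0// ltW.
- by lra.
- by rewrite mulrAC.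
move=> m x.
have := @dbound_prod (fun m x => s ^+ m *: dchi m (s * x)) phi K b h h m x
  (jet_dilate s chi_jet) sp K0 b0 (ltW h0) (ltW h0).
rewrite (_ : (fun x => _) = cutf s phi); last by apply/funext => y; rewrite expr0 scale1r.
apply=> l //; rewrite normrZ gtr0_norm ?exprn_gt0//.
apply: le_trans (ler_wpM2l _ (HK l _)) _; first by rewrite exprn_ge0// ltW.
rewrite expr_div_n le_eqVlt; apply/orP; left; apply/eqP; field.
by rewrite expf_neq0// gt_eqF.
Qed.

Lemma cutf_smooth s phi : smooth phi -> smooth (cutf s phi).
Proof.
move=> sp; have := smooth_prod (jet_dilate s chi_jet) sp.
by rewrite (_ : (fun x => _) = cutf s phi)//; apply/funext => y; rewrite expr0 scale1r.
Qed.

Lemma cutf_testclass s n a phi : 0 < s -> 0 <= a -> Zclass M n a phi ->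
  testclass M (3 * a) (2 / s) (cutf s phi).
Proof.
move=> s0 a0 [sp bp]; split; first exact: cutf_smooth.
- move=> x; rewrite ltr_pdivrMr// => xs; rewrite /cutf chi0 ?scale0r//.
  by rewrite normrM gtr0_norm// mulrC ltW.
- move=> h ah; have ah3 : a < h / 3 by lra.
  have h0 : 0 < h / 3 by lra.
  have [b /Zbound_dbound Hb] := bp _ ah3.
  have [K K0 HK] := cutf_bound s0 h0.
  by exists (K * b); have := HK _ _ sp Hb; rewrite mulrCA divff ?mulr1.
Qed.

(** At [s = 2] this is the ring of index [k] brought back to unit scale; the other [s] in [[1, 2]]
    compare a dyadic cutoff with a non-dyadic one. *)
Definition ring_cut s k phi : fct :=
  fun y => (dchi 0%N y - dchi 0%N (s * y)) *: phi (2 ^+ k * y).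

Lemma ring_cut_jet s : jet (V := R) (fun m y => dchi m y - s ^+ m *: dchi m (s * y)).
Proof.
by move=> m x; have h := jet_dilate s chi_jet m x; exact: is_deriveB (chi_jet m x) h.
Qed.

Lemma ring_cutE s k phi x :
  ring_cut s k phi (2 ^- k * x) = sub_fct (cutf (2 ^- k) phi) (cutf (s * 2 ^- k) phi) x.
Proof.
by rewrite /ring_cut /sub_fct /cutf mulVKf ?expf_neq0// mulN1r [RHS]addrC scalerBl mulrA.
Qed.

(** Both cutoffs are 1 for [|y| < 1/2]. Elsewhere [1 + |2 ^+ k * y|] is at least [2 ^+ k / 2]: of
    its [n + l] powers, [l] pay for the chain rule and [n] give the decay. The halves cost [2 ^+ n]
    and turn [h] into [2 * h], which with the [h] of chi makes [3 * h]. As [s <= 2], the bound of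
    chi at [h / 2] makes [K] uniform in [s]. *)
Lemma ring_cut_bound n h : 0 < h -> exists2 K, 0 <= K & forall s k phi b,
  1 <= s <= 2 -> smooth phi -> Zbound M n h b phi ->
  dbound M (3 * h) (K * b / 2 ^+ (k * n)) (ring_cut s k phi).
Proof.
move=> h0; have [K1 K10 HK1] := chi_bound h0.
have h20 : 0 < h / 2 by lra.
have [K2 K20 HK2] := chi_bound h20.
exists ((K1 + K2) * 2 ^+ n * M 0%N); first by rewrite !mulr_ge0 ?addr_ge0 ?exprn_ge0// ltW.
move=> s k phi b /andP[s1 s2] sp Zb; have b0 := Zbound_ge0 M_gt0 Zb.
have k0 (j : nat) : 0 < 2 ^+ j :> R by rewrite exprn_gt0.
move=> m x; have [x2|x2] := ltP `|x| 2^-1.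
  rewrite (@derive1n_eq0 _ _ _ 2^-1) ?normr0//.
    rewrite mulr_ge0 ?weight_scale_ge0//; last by lra.
    by rewrite ?mulr_ge0 ?invr_ge0 ?exprn_ge0 ?addr_ge0 ?(ltW (M_gt0 _)).
  move=> y y2; rewrite /ring_cut !chi1 ?subrr ?scale0r//; last by lra.
  by rewrite normrM ger0_norm; nra.
rewrite (_ : _ * b / _ = (K1 + K2) * (b * 2 ^+ n / 2 ^+ (k * n)) * M 0%N); last by ring.
rewrite (_ : 3 * h = h + 2 * h); last by ring.
rewrite (_ : ring_cut s k phi =
    (fun y => (dchi 0%N y - s ^+ 0 *: dchi 0%N (s * y)) *: phi (2 ^+ k * y))); last first.
  by apply/funext => y; rewrite expr0 scale1r.
apply: (@dbound_prod (fun m y => dchi m y - s ^+ m *: dchi m (s * y)) (fun y => phi (2 ^+ k * y))).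
- exact: ring_cut_jet.
- exact: smooth_dilate.
- exact: addr_ge0.
- by rewrite divr_ge0 ?mulr_ge0 ?exprn_ge0.
- exact: ltW.
- by lra.
- move=> l; apply: le_trans (ler_normB _ _) _; rewrite mulrDl lerD//.
  rewrite normrZ ger0_norm ?exprn_ge0//; last by lra.
  apply: le_trans (ler_pM _ _ (_ : s ^+ l <= 2 ^+ l) (HK2 l _)) _ => //.
  + by rewrite exprn_ge0//; lra.
  + by rewrite lerXn2r ?nnegrE//; lra.
  + rewrite expr_div_n le_eqVlt; apply/orP; left; apply/eqP; field.
    by rewrite expf_neq0.
- move=> l; rewrite derive1n_dilate// normrZ ger0_norm ?exprn_ge0//.
  have := Zb l (2 ^+ k * x); set X := `|derive1n _ _ _| => HX.
  have X0 : 0 <= X by exact: normr_ge0.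
  have h1 : 2 ^+ k / 2 <= 1 + `|2 ^+ k * x|.
    by rewrite normrM ger0_norm ?(ltW (k0 _))//; have := k0 k; nra.
  have h2 : (2 ^+ k / 2) ^+ (n + l) * X <= b * (h ^+ l * M l).
    apply: le_trans HX; apply: ler_wpM2r => //.
    by rewrite lerXn2r ?nnegrE ?divr_ge0 ?exprn_ge0// addr_ge0.
  rewrite -exprM.
  have -> : 2 ^+ (k * l) * X = (2 ^+ k / 2) ^+ (n + l) * X * (2 ^+ (n + l) / 2 ^+ (k * n)).
    by rewrite expr_div_n -exprM mulnDr !exprD; field; rewrite !expf_neq0.
  apply: le_trans (ler_wpM2r _ h2) _; first by rewrite divr_ge0 ?exprn_ge0.
  by rewrite exprMn exprD le_eqVlt; apply/orP; left; apply/eqP; ring.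
Qed.

Lemma ring_cut_testclass n s k a phi : 1 <= s <= 2 -> 0 <= a -> Zclass M n a phi ->
  testclass M (3 * a) 2 (ring_cut s k phi).
Proof.
move=> s12 a0 [sp bp]; split.
- have := smooth_prod (ring_cut_jet s) (smooth_dilate (s := 2 ^+ k) sp).
  by rewrite (_ : (fun x => _) = ring_cut s k phi)//; apply/funext => y; rewrite expr0 scale1r.
- move=> x x2; rewrite /ring_cut !chi0 ?subrr ?scale0r//; last exact: ltW.
  by rewrite normrM ger0_norm; have := normr_ge0 x; move: s12 => /andP[]; nra.
- move=> h ah; have ah3 : a < h / 3 by lra.
  have h0 : 0 < h / 3 by lra.
  have [b Hb] := bp _ ah3.
  have [K K0 HK] := ring_cut_bound n h0.
  by eexists; have := HK s k phi _ s12 sp Hb; rewrite mulrCA divff ?mulr1//; exact.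
Qed.

End cutoffs.

(** * Extension to Z *)

Section auxiliary.
Variable R : realType.
Notation C := (Rcomplex R).

Lemma geometric_lim (u : nat -> C) (K : R) :
  (forall k, `|u k.+1 - u k| <= K / 2 ^+ k) ->
  exists l : C, u @ \oo --> l /\ forall k, `|l - u k| <= 2 * K / 2 ^+ k.
Proof.
move=> H; have K0 : 0 <= K.
  by have := le_trans (normr_ge0 _) (H 0%N); rewrite expr0 divr1.
have step k i : `|u (k + i)%N - u k| <= 2 * K / 2 ^+ k - 2 * K / 2 ^+ (k + i).
  elim: i => [|i IH]; first by rewrite addn0 !subrr normr0.
  rewrite addnS; apply: le_trans (ler_distD (u (k + i)%N) _ _) _.
  apply: le_trans (lerD (H _) IH) _; rewrite exprS invfM.
  by rewrite le_eqVlt; apply/orP; left; apply/eqP; field; rewrite !expf_neq0.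
apply: (@cauchy_lim _ _ (fun k => 2 * K / 2 ^+ k)) => [|k k' /subnKC <-].
  rewrite -[X in _ --> X](mulr0 (2 * K)); apply: cvgM; first exact: cvg_cst.
  rewrite (_ : (fun _ => _) = (fun k => 2^-1 ^+ k)); last by apply/funext => k; rewrite exprVn.
  by apply: cvg_expr; rewrite ger0_norm; lra.
apply: le_trans (step _ _) _; rewrite gerBl divr_ge0 ?mulr_ge0 ?exprn_ge0//.
Qed.

Lemma dyadic_floor (l : R) : 1 <= l -> exists m, 2 ^+ m <= l <= 2 ^+ m.+1.
Proof.
move=> l1; have ex : exists m, l < 2 ^+ m.
  exists (Num.truncn l).+1; apply: lt_le_trans (truncnS_gt l) _.
  by rewrite -natrX ler_nat ltnW// ltn_expl.
have [[|m] lm minm] := ex_minnP ex.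
  by move: lm; rewrite expr0 ltNge l1.
exists m; rewrite (ltW lm) andbT leNgt; apply/negP => /minm.
by rewrite ltnn.
Qed.

Lemma dilateE (l : R) (f : (R -> C) -> C) phi :
  dilate l f phi = l^-1 *: f (fun x => phi (l^-1 * x)).
Proof.
by rewrite /dilate; congr (_ *: f _); apply/funext => x; rewrite mulrC.
Qed.

Lemma norm_lim_le (u : R -> C) (z : C) (B l0 : R) : u l @[l --> +oo] --> z ->
  (forall l, l0 <= l -> `|u l| <= B) -> `|z| <= B.
Proof.
move=> /cvg_norm uz H; rewrite -(cvg_lim _ uz)//; apply: limr_le.
  by apply/cvg_ex; eexists; exact: uz.
by apply: filterS (nbhs_pinfty_ge (num_real l0)) => l; exact: H.
Qed.

Lemma scale_norm (t : R) (z : C) : 0 <= t -> `|t *: z| = t * `|z|.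
Proof. by move=> t0; rewrite normrZ ger0_norm. Qed.

Lemma slowly_varying_double (L : R -> R) : slowly_varying L ->
  exists2 L0, 1 <= L0 & forall l, L0 <= l -> 0 < L l /\ L (2 * l) <= 2 * L l.
Proof.
move=> [_ Lpos /(_ 2 (ltr0Sn _ 1))/cvgrPdist_lt /(_ 1 ltr01) H].
have [B [_ HB]] : \forall x \near +oo, 0 < L x /\ `|1 - L (2 * x) / L x| < 1.
  by apply: filterS2 Lpos H.
exists (Num.max (B + 1) 1); first by rewrite le_max lexx orbT.
move=> l; rewrite ge_max => /andP[lB l1].
have [|Ll] := HB l; first by apply: lt_le_trans lB; rewrite ltrDl.
rewrite distrC ltr_norml => /andP[_]; rewrite ltrBlDr => h; split => //.
by rewrite -ler_pdivrMr// ltW//; apply: lt_le_trans h _; lra.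
Qed.

End auxiliary.

(** * Ring estimates for f and g, and limits along the cutoffs *)

Section extension.
Variables (R : realType) (M : nat -> R) (k : ultra_kind) (alpha : R) (L : R -> R).
Notation C := (Rcomplex R).
Notation fct := (R -> C).
Variables (f g : fct -> C).
Hypothesis M_gt0 : forall p, 0 < M p.
Hypothesis MM : forall p q, M p * M q <= M 0%N * M (p + q)%N.
Variable dchi : nat -> R -> R.
Hypothesis chi_jet : jet (V := R) dchi.
Hypothesis chi1 : forall x, `|x| <= 1 -> dchi 0%N x = 1.
Hypothesis chi0 : forall x, 2 <= `|x| -> dchi 0%N x = 0.
Hypothesis chi_bound : forall h, 0 < h ->
  exists2 C, 0 <= C & forall m x, `|dchi m x| <= C * (h ^+ m * M m).
Variable L0 : R.
Hypothesis L0_ge1 : 1 <= L0.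
Hypothesis L_double : forall l, L0 <= l -> 0 < L l /\ L (2 * l) <= 2 * L l.
Variable n : nat.
Hypothesis n_ge : alpha + 3 <= n%:R.
Hypothesis quasi : quasiasymptotic (D_space k M) alpha L f g.
Implicit Types (z : C) (phi psi : fct) (a h r c s l : R) (j i : nat).

Let df : dual (D_space k M) f. Proof. by case: quasi. Qed.
Let dg : dual (D_space k M) g. Proof. by case: quasi. Qed.

Let N l := l `^ alpha * L l.
Let T l phi := (N l)^-1 *: dilate l f phi.
Let ck j phi := cutf dchi (2 ^- j) phi.

Let pow2_gt0 j : 0 < 2 ^+ j :> R. Proof. by rewrite exprn_gt0. Qed.

Let N_gt0 l : L0 <= l -> 0 < N l.
Proof.
move=> Ll; rewrite mulr_gt0//; last by have [] := L_double Ll.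
by rewrite powR_gt0// (lt_le_trans ltr01)// (le_trans L0_ge1).
Qed.

Let le_pow2M j l : L0 <= l -> L0 <= 2 ^+ j * l.
Proof.
move=> Ll; apply: (le_trans Ll); rewrite ler_peMl ?exprn_ege1 ?ler1n//.
by rewrite (le_trans ler01)// (le_trans L0_ge1).
Qed.

Lemma L_pow2 j l : L0 <= l -> L (2 ^+ j * l) <= 2 ^+ j * L l.
Proof.
move=> Ll; elim: j => [|j IH]; first by rewrite !expr0 !mul1r.
rewrite exprS -mulrA; have [_ h] := L_double (le_pow2M j Ll); apply: le_trans h _.
by rewrite -mulrA ler_wpM2l.
Qed.

(** The origin of [alpha + 3]: the power of lambda takes [alpha], the doubling bound on [L] takes 1,
    the Jacobian of the dilation takes 1, and 1 is left for the geometric decay. *)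
Lemma N_pow2 j l : L0 <= l -> N (2 ^+ j * l) * (2 ^+ j * 2 ^+ j) <= N l * 2 ^+ (j * n).
Proof.
move=> Ll; have l0 : 0 < l by rewrite (lt_le_trans ltr01)// (le_trans L0_ge1).
have [Lp _] := L_double Ll.
rewrite /N powRM ?(ltW l0) ?(ltW (pow2_gt0 _))//.
apply: le_trans (_ : (2 ^+ j) `^ alpha * l `^ alpha * (2 ^+ j * L l) * (2 ^+ j * 2 ^+ j) <= _).
  rewrite ler_wpM2r ?mulr_ge0 ?exprn_ge0//.
  by rewrite ler_wpM2l ?mulr_ge0 ?powR_ge0// L_pow2.
rewrite (_ : _ * _ = l `^ alpha * L l * ((2 ^+ j) `^ alpha * (2 ^+ j) ^+ 3)); last by ring.
rewrite ler_wpM2l ?mulr_ge0 ?powR_ge0 ?(ltW Lp)//.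
rewrite -[(2 ^+ j) ^+ 3]powR_mulrn ?exprn_ge0// -powRD; last by apply/implyP => _; rewrite gt_eqF.
rewrite exprM -[(2 ^+ j) ^+ n]powR_mulrn ?exprn_ge0//.
by rewrite ler_powR// exprn_ege1// ler1n.
Qed.

Lemma admissible3 a : admissible k a -> admissible k (3 * a).
Proof. by rewrite /admissible; case: k => [->|a0]; rewrite ?mulr0// mulr_gt0. Qed.

Lemma dbound_dilate s h b phi : 0 <= s -> s <= 1 -> 0 <= h -> smooth phi ->
  dbound M h b phi -> dbound M h b (fun x => phi (s * x)).
Proof.
move=> s0 s1 h0 sp db m x; rewrite derive1n_dilate// scale_norm ?exprn_ge0//.
apply: le_trans (db m (s * x)); rewrite ler_piMl// exprn_ile1//.
Qed.

Lemma testclass_dilate a r l phi : 1 <= l -> 0 <= a -> testclass M a r phi ->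
  testclass M a (l * r) (fun x => phi (l^-1 * x)).
Proof.
move=> l1 a0 [sp op bp]; have l0 : 0 < l by exact: lt_le_trans l1.
split; first exact: smooth_dilate.
- move=> x rx; apply: op; rewrite normrM ger0_norm ?invr_ge0 ?ltW//.
  by rewrite mulrC ltr_pdivlMr// mulrC.
- move=> h ah; have [b Hb] := bp h ah; exists b; apply: dbound_dilate => //.
  + by rewrite invr_ge0 ltW.
  + by rewrite invf_le1.
  + by rewrite (le_trans a0)// ltW.
Qed.

Lemma T_linear a r l : admissible k a -> 1 <= l -> linear_on (testclass M a r) (T l).
Proof.
move=> aa l1 z phi psi tp tq; have a0 := admissible_ge0 aa.
rewrite /T !dilateE.
rewrite (D_dual_linear M_gt0 df aa z (testclass_dilate l1 a0 tp) (testclass_dilate l1 a0 tq)).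
by rewrite !scalerDr !RcomplexZ !mulrA; congr (_ + _); ring.
Qed.

Lemma T_cvg a r phi : admissible k a -> testclass M a r phi -> T l phi @[l --> +oo] --> g phi.
Proof. by move=> aa tp; have [_ _] := quasi; apply; exact: (D_carrier M_gt0 aa tp). Qed.

Lemma T_uniform a r : admissible k a -> exists h c l0, [/\ a < h, L0 <= l0, 0 <= c &
  forall l phi b, l0 <= l -> testclass M a r phi -> dbound M h b phi -> `|T l phi| <= c * b].
Proof.
move=> aa; have a0 := admissible_ge0 aa.
have [||phi tp|h [c [l0 [ah l01 c0 H]]]] := @uniform_boundedness R M M_gt0 a r T a0.
- by move=> l l1; exact: T_linear.
- move=> l l1; have l0 : 0 < l by exact: lt_le_trans l1.
  have [h [c [ah H]]] := D_dual_bound M_gt0 (l * r) df aa.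
  (* Below [L0] the sign of [N l] is unknown, hence the modulus. As [1 <= l], dilating enlarges the
     support to [l * r] but no derivative. *)
  exists h, (`|(N l)^-1 * l^-1| * c); split => // phi b tp db.
  rewrite /T dilateE scalerA normrZ -mulrA ler_wpM2l// H//; first exact: testclass_dilate.
  have [sp _ _] := tp; apply: dbound_dilate => //.
  + by rewrite invr_ge0 ltW.
  + by rewrite invf_le1.
  + by rewrite (le_trans a0)// ltW.
- have /cvgrPdist_lt /(_ 1 ltr01) [B [_ HB]] := T_cvg aa tp.
  exists (`|g phi| + 1), (B + 1) => l lB; have := HB l; rewrite /= => /(_ _)/ltW h.
  rewrite addrC -lerBlDr; apply: le_trans (lerB_dist _ _) _; rewrite distrC; apply: h.
  by apply: lt_le_trans lB; rewrite ltrDl.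
- exists h, c, (Num.max l0 L0); split => //; first by rewrite le_max lexx orbT.
  by move=> l phi b; rewrite ge_max => /andP[ll _]; exact: H.
Qed.

Lemma T_f l phi : L0 <= l -> f (fun x => phi (l^-1 * x)) = (N l * l) *: T l phi.
Proof.
move=> Ll; have l0 : 0 < l by rewrite (lt_le_trans ltr01)// (le_trans L0_ge1).
rewrite /T dilateE !scalerA (_ : N l * l * _ = 1) ?scale1r//.
by field; rewrite !gt_eqF ?N_gt0.
Qed.

Lemma T_E l phi : T l phi = (N l * l)^-1 *: f (fun x => phi (l^-1 * x)).
Proof. by rewrite /T dilateE scalerA -invfM. Qed.

(** The difference of cutoffs, dilated by [l], is a function supported in [[-2, 2]] dilated by
    [mu = 2 ^+ j * l]. Only [mu >= l0] is required, which covers large [l] with any [j] as well as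
    [l = 1] with large [j]. *)
Lemma piece_bound a : admissible k a -> exists h c l0, [/\ a < h, L0 <= l0, 0 <= c &
  forall s j l phi b, 1 <= s <= 2 -> l0 <= 2 ^+ j * l -> Zclass M n a phi -> Zbound M n h b phi ->
  `|f (fun x => sub_fct (ck j phi) (cutf dchi (s * 2 ^- j) phi) (l^-1 * x))| <=
  N (2 ^+ j * l) * (2 ^+ j * l) * (c * b / 2 ^+ (j * n))].
Proof.
move=> aa; have a0 := admissible_ge0 aa.
have [h [c [l0 [ah Ll0 c0 H]]]] := T_uniform 2 (admissible3 aa).
have h0 : 0 < h / 3 by lra.
have [K K0 HK] := ring_cut_bound M_gt0 MM chi_jet chi1 chi_bound n h0.
exists (h / 3), (c * K), l0; split => //; [lra|exact: mulr_ge0|].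
move=> s j l phi b s12 ll Zc Zb; have Ll := le_trans Ll0 ll.
have [sp _] := Zc.
rewrite (_ : (fun x => _) = (fun x => ring_cut dchi s j phi ((2 ^+ j * l)^-1 * x))); last first.
  by apply/funext => x; rewrite -ring_cutE invfM -mulrA.
have mu0 : 0 <= N (2 ^+ j * l) * (2 ^+ j * l).
  rewrite mulr_ge0 ?(ltW (N_gt0 Ll))// (le_trans ler01)//.
  exact: le_trans L0_ge1 Ll.
rewrite T_f// scale_norm// ler_wpM2l//.
have tc := ring_cut_testclass M_gt0 MM chi_jet chi1 chi0 chi_bound j s12 a0 Zc.
have db := HK s j phi b s12 sp Zb.
rewrite mulrCA divff// mulr1 in db.
by apply: le_trans (H _ _ _ ll tc db) _; rewrite !mulrA.
Qed.

Lemma testclass_le a r r' phi : r <= r' -> testclass M a r phi -> testclass M a r' phi.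
Proof. by move=> rr [sp op bp]; split => // x /(le_lt_trans rr)/op. Qed.

Lemma linear_on_sub (P : fct -> Prop) (S : fct -> C) phi psi :
  linear_on P S -> P phi -> P psi -> S (sub_fct phi psi) = S phi - S psi.
Proof. by move=> Sl p q; rewrite Sl// mulN1r addrC. Qed.

Lemma cutf_sub (S : fct -> C) a s s' phi : 0 < s -> 0 < s' -> 0 <= a -> Zclass M n a phi ->
  (forall r, linear_on (testclass M (3 * a) r) S) ->
  S (sub_fct (cutf dchi s phi) (cutf dchi s' phi)) = S (cutf dchi s phi) - S (cutf dchi s' phi).
Proof.
move=> s0 s'0 a0 Zc Sl.
apply: (linear_on_sub (Sl (Num.max (2 / s) (2 / s')))).
  apply: testclass_le (cutf_testclass M_gt0 MM chi_jet chi0 chi_bound s0 a0 Zc).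
  by rewrite le_max lexx.
apply: testclass_le (cutf_testclass M_gt0 MM chi_jet chi0 chi_bound s'0 a0 Zc).
by rewrite le_max lexx orbT.
Qed.

Lemma ck_half j phi : cutf dchi (2 * 2 ^- j.+1) phi = ck j phi.
Proof. by rewrite exprS invfM mulrA divff// mul1r. Qed.

Lemma T_piece a : admissible k a -> exists h c l0, [/\ a < h, L0 <= l0, 0 <= c &
  forall s j l phi b, 1 <= s <= 2 -> l0 <= l -> Zclass M n a phi -> Zbound M n h b phi ->
  `|T l (ck j phi) - T l (cutf dchi (s * 2 ^- j) phi)| <= c * b / 2 ^+ j].
Proof.
move=> aa; have a0 := admissible_ge0 aa.
have [h [c [l0 [ah Ll0 c0 H]]]] := piece_bound aa.
exists h, c, l0; split => // s j l phi b s12 ll Zc Zb.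
have Ll := le_trans Ll0 ll.
have l1 := le_trans L0_ge1 Ll; have lp : 0 < l by exact: lt_le_trans l1.
have lj : l0 <= 2 ^+ j * l.
  by rewrite (le_trans ll)// ler_peMl ?exprn_ege1 ?ler1n// ltW.
have [s1 s2] := andP s12.
rewrite -(cutf_sub _ _ a0 Zc); first last.
- by move=> r; apply: T_linear => //; exact: admissible3.
- by rewrite mulr_gt0 ?invr_gt0//; lra.
- by rewrite invr_gt0.
have b0 := Zbound_ge0 M_gt0 Zb.
have NL := N_gt0 Ll.
have Nl0 : 0 < N l * l by exact: mulr_gt0.
rewrite T_E scale_norm ?invr_ge0 ?(ltW Nl0)//.
have k0 := pow2_gt0 j; have Q0 := pow2_gt0 (j * n).
apply: le_trans (ler_wpM2l _ (H s j l phi b s12 lj Zc Zb)) _.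
  by rewrite invr_ge0 ltW.
(* The factor by which the inequality [N_pow2] is multiplied: its right side becomes
   [c * b / 2 ^+ j]. *)
pose X := c * b / (N l * 2 ^+ (j * n) * 2 ^+ j).
have X0 : 0 <= X.
  by apply: divr_ge0; [exact: mulr_ge0|apply/ltW/mulr_gt0 => //; exact: mulr_gt0].
have := ler_wpM2r X0 (N_pow2 j Ll); rewrite /X => h2.
rewrite [leLHS](_ : _ = N (2 ^+ j * l) * (2 ^+ j * 2 ^+ j) * X); last first.
  by rewrite /X; field; rewrite !gt_eqF.
by apply: le_trans h2 _; rewrite le_eqVlt; apply/orP; left; apply/eqP; field; rewrite !gt_eqF.
Qed.

(** The case [s = 2], [l = 1] of [piece_bound]. The rings start where [2 ^+ j] has passed [l0], and
    the growth of [N] is measured from that power of 2, since nothing is known of [N] near 1. *)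
Lemma f_piece a : admissible k a -> exists h c j0, [/\ a < h, 0 <= c &
  forall j phi b, Zclass M n a phi -> Zbound M n h b phi ->
  `|f (ck (j0 + j).+1 phi) - f (ck (j0 + j) phi)| <= c * b / 2 ^+ j].
Proof.
move=> aa; have a0 := admissible_ge0 aa.
have [h [c [l0 [ah Ll0 c0 H]]]] := piece_bound aa.
have [j0 /andP[_ lj0]] := dyadic_floor (le_trans L0_ge1 Ll0).
have Lj0 := le_trans Ll0 lj0; have N0 := N_gt0 Lj0.
exists h, (N (2 ^+ j0.+1) * 2 ^+ j0.+1 / 2 ^+ (j0.+1 * n) * c), j0.+1; split => //.
  by rewrite mulr_ge0// divr_ge0 ?exprn_ge0// mulr_ge0 ?exprn_ge0// ltW.
move=> j phi b Zc Zb; have b0 := Zbound_ge0 M_gt0 Zb.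
rewrite -[ck (_ + _) phi]ck_half -(cutf_sub _ _ a0 Zc); first last.
- by move=> r; exact: (D_dual_linear M_gt0 df (admissible3 aa)).
- by rewrite mulr_gt0 ?invr_gt0.
- by rewrite invr_gt0.
have s12 : 1 <= (2 : R) <= 2 by lra.
have jj : 2 ^+ (j0.+1 + j).+1 = 2 ^+ j.+1 * 2 ^+ j0.+1 :> R by rewrite -exprD addSn addnC -addSnnS.
have := H 2 (j0.+1 + j).+1 1 phi b s12 _ Zc Zb.
rewrite mulr1 invr1 (_ : (fun x => _) =
    sub_fct (ck (j0.+1 + j).+1 phi) (cutf dchi (2 * 2 ^- (j0.+1 + j).+1) phi)); last first.
  by apply/funext => x; rewrite mul1r.
move=> K; apply: le_trans (K _) _.
  by rewrite jj (le_trans lj0)// ler_peMl ?exprn_ege1 ?ler1n.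
rewrite jj.
have -> : 2 ^+ ((j0.+1 + j).+1 * n) = 2 ^+ (j.+1 * n) * 2 ^+ (j0.+1 * n) :> R.
  by rewrite -exprD -mulnDl addSn addnC -addSnnS.
have P := N_pow2 j.+1 Lj0.
have k0 := pow2_gt0 j.+1; have k1 := pow2_gt0 j0.+1; have Q0 := pow2_gt0 (j.+1 * n).
have Q1 := pow2_gt0 (j0.+1 * n).
pose X := 2 ^+ j0.+1 * c * b / (2 ^+ j.+1 * 2 ^+ (j.+1 * n) * 2 ^+ (j0.+1 * n)).
have X0 : 0 <= X by rewrite divr_ge0 ?mulr_ge0 ?mulr_ge0 ?exprn_ge0//.
have := ler_wpM2r X0 P; rewrite /X => h2.
rewrite [leLHS](_ : _ = N (2 ^+ j.+1 * 2 ^+ j0.+1) * (2 ^+ j.+1 * 2 ^+ j.+1) * X); last first.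
  by rewrite /X; field; rewrite !gt_eqF.
apply: le_trans h2 _.
rewrite [leLHS](_ : _ =
    N (2 ^+ j0.+1) * 2 ^+ j0.+1 / 2 ^+ (j0.+1 * n) * c * b / 2 ^+ j.+1); last first.
  by field; rewrite !gt_eqF.
have K0 : 0 <= N (2 ^+ j0.+1) * 2 ^+ j0.+1 / 2 ^+ (j0.+1 * n) * c * b.
  by rewrite mulr_ge0// mulr_ge0// divr_ge0 ?exprn_ge0// mulr_ge0 ?exprn_ge0// ltW.
apply: ler_wpM2l => //; by rewrite lef_pV2 ?posrE// exprS ler_peMl// ler1n.
Qed.

(** The extension of [S]. As [lim] is arbitrary on divergent sequences, values are read off through
    [cutlimE] after convergence is shown. *)
Definition cutlim (S : fct -> C) phi : C := lim ((fun j => S (ck j phi)) @ \oo).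

Lemma cutlimE (S : fct -> C) phi (z : C) : (fun j => S (ck j phi)) @ \oo --> z -> cutlim S phi = z.
Proof. exact: cvg_lim. Qed.

Lemma cutlim_linear (S : fct -> C) a : 0 <= a ->
  (forall r, linear_on (testclass M (3 * a) r) S) ->
  (forall phi, Zclass M n a phi -> exists z, (fun j => S (ck j phi)) @ \oo --> (z : C)) ->
  linear_on (Zclass M n a) (cutlim S).
Proof.
move=> a0 Sl ex z phi psi Zp Zq.
have [w1 h1] := ex _ Zp; have [w2 h2] := ex _ Zq.
rewrite (cutlimE h1) (cutlimE h2); apply: cutlimE.
rewrite (_ : (fun j => _) = (fun j => z * S (ck j phi) + S (ck j psi))).
  apply: cvgD => //; apply/cvgrPdist_le => e e0.
  have z1 : 0 < `|z| + 1 by rewrite ltr_pwDr.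
  have /cvgrPdist_le /(_ _ (divr_gt0 e0 z1)) := h1; apply: filterS => j hj.
  rewrite -mulrBr Rcomplex_normM; apply: le_trans (ler_wpM2l (normr_ge0 _) hj) _.
  by rewrite mulrCA ger_pMr// ler_pdivrMr// mul1r lerDl.
apply/funext => j; have q0 : 0 < 2 ^- j :> R by rewrite invr_gt0.
have tc := cutf_testclass M_gt0 MM chi_jet chi0 chi_bound q0 a0.
rewrite /ck cutf_lin (Sl (2 / 2 ^- j))//; [exact: tc Zp|exact: tc Zq].
Qed.

Lemma T_ck0 a : admissible k a -> exists h c l0, [/\ a < h, L0 <= l0, 0 <= c &
  forall l phi b, l0 <= l -> Zclass M n a phi -> Zbound M n h b phi ->
  `|T l (ck 0 phi)| <= c * b].
Proof.
move=> aa; have a0 := admissible_ge0 aa.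
have [h [c [l0 [ah Ll0 c0 H]]]] := T_uniform (2 / 2 ^- 0) (admissible3 aa).
have h0 : 0 < h / 3 by lra.
have q0 : 0 < 2 ^- 0 :> R by rewrite invr_gt0.
have [K K0 HK] := cutf_bound M_gt0 MM chi_jet chi_bound q0 h0.
exists (h / 3), (c * K), l0; split => //; [lra|exact: mulr_ge0|].
move=> l phi b ll Zc Zb; have [sp _] := Zc.
have := HK _ _ sp (Zbound_dbound Zb); rewrite mulrCA divff// mulr1 -mulrA.
by apply: H => //; exact: (cutf_testclass M_gt0 MM chi_jet chi0 chi_bound q0 a0 Zc).
Qed.

(** The part inside the cutoff [j0] is controlled by continuity of [f] on a fixed compact interval,
    the rings beyond it by a geometric series. *)
Lemma f_extension a : admissible k a -> exists h c, [/\ a < h, 0 <= c &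
  forall phi b, Zclass M n a phi -> Zbound M n h b phi ->
  exists z : C, (fun j => f (ck j phi)) @ \oo --> z /\ `|z| <= c * b].
Proof.
move=> aa; have a0 := admissible_ge0 aa.
have [h [c [j0 [ah c0 H]]]] := f_piece aa.
have [h1 [c1 [ah1 H1]]] := D_dual_bound M_gt0 (2 / 2 ^- j0) df (admissible3 aa).
have h10 : 0 < h1 / 3 by lra.
have q0 : 0 < 2 ^- j0 :> R by rewrite invr_gt0.
have [K K0 HK] := cutf_bound M_gt0 MM chi_jet chi_bound q0 h10.
have ah13 : a < h1 / 3 by lra.
have m0 : 0 <= Num.min h (h1 / 3) by rewrite le_min !(le_trans a0) ?ltW.
exists (Num.min h (h1 / 3)), (`|c1| * K + 2 * c); split.
- by rewrite lt_min ah ah13.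
- by rewrite addr_ge0 ?mulr_ge0.
move=> phi b Zc Zb.
have Zb1 : Zbound M n h b phi by apply: Zbound_le Zb => //; rewrite ge_min lexx.
have Zb2 : Zbound M n (h1 / 3) b phi.
  by apply: Zbound_le Zb => //; rewrite ge_min lexx orbT.
have b0 := Zbound_ge0 M_gt0 Zb.
have step j : `|f (ck (j0 + j.+1) phi) - f (ck (j0 + j) phi)| <= c * b / 2 ^+ j.
  by rewrite addnS; exact: H.
have [z [uz zb]] := @geometric_lim R (fun j => f (ck (j0 + j) phi)) (c * b) step.
exists z; split.
  rewrite -(cvg_shiftn j0); rewrite (_ : (fun _ => _) = (fun j => f (ck (j0 + j) phi)))//.
  by apply/funext => j; rewrite addnC.
have [sp _] := Zc.
have h2 : `|f (ck j0 phi)| <= `|c1| * K * b.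
  have := HK _ _ sp (Zbound_dbound Zb2); rewrite mulrCA divff// mulr1 => db.
  apply: le_trans (H1 _ _ _ db) _.
    exact: (cutf_testclass M_gt0 MM chi_jet chi0 chi_bound q0 a0 Zc).
  by rewrite -mulrA ler_wpM2r ?mulr_ge0// ler_norm.
have := zb 0%N; rewrite addn0 expr0 divr1 => h3.
rewrite mulrDl; apply: le_trans (_ : `|f (ck j0 phi)| + `|z - f (ck j0 phi)| <= _).
  by rewrite -{1}(subrK (f (ck j0 phi)) z) addrC; exact: ler_normD.
by rewrite lerD// -mulrA.
Qed.

(** The estimates for [g] are limits of those for [T l]. The number [w] is the normalised value of
    the extended [f] at [phi (l^-1 * x)]; its rate in [j] does not depend on [l], which later allows
    the limits to be exchanged. *)
Lemma g_extension a : admissible k a -> exists h c l0, [/\ a < h, L0 <= l0, 0 <= c &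
  forall phi b, Zclass M n a phi -> Zbound M n h b phi ->
  (exists z : C, [/\ (fun j => g (ck j phi)) @ \oo --> z, `|z| <= c * b &
     forall j, `|z - g (ck j phi)| <= c * b / 2 ^+ j]) /\
  forall l, l0 <= l -> exists w : C,
    (fun j => f (ck j (fun x => phi (l^-1 * x)))) @ \oo --> (N l * l) *: w /\
    forall j, `|w - T l (ck j phi)| <= c * b / 2 ^+ j].
Proof.
move=> aa; have a0 := admissible_ge0 aa.
have [h1 [c1 [l1 [ah1 Ll1 c10 H1]]]] := T_piece aa.
have [h2 [c2 [l2 [ah2 Ll2 c20 H2]]]] := T_ck0 aa.
have m0 : 0 <= Num.min h1 h2 by rewrite le_min !(le_trans a0) ?ltW.
exists (Num.min h1 h2), (2 * c1 + c2), (Num.max l1 l2); split.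
- by rewrite lt_min ah1.
- by rewrite le_max Ll1.
- by rewrite addr_ge0// mulr_ge0.
move=> phi b Zc Zb.
have Zb1 : Zbound M n h1 b phi by apply: Zbound_le Zb => //; rewrite ge_min lexx.
have Zb2 : Zbound M n h2 b phi by apply: Zbound_le Zb => //; rewrite ge_min lexx orbT.
have b0 := Zbound_ge0 M_gt0 Zb.
have le12 j : 2 * (c1 * b) / 2 ^+ j <= (2 * c1 + c2) * b / 2 ^+ j.
  by rewrite ler_pM2r ?invr_gt0// mulrA ler_wpM2r// lerDl.
have stepT l j : l1 <= l -> `|T l (ck j.+1 phi) - T l (ck j phi)| <= c1 * b / 2 ^+ j.
  move=> ll; have s12 : 1 <= (2 : R) <= 2 by lra.
  have := H1 2 j.+1 l phi b s12 ll Zc Zb1; rewrite ck_half => /le_trans; apply.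
  by rewrite ler_wpM2l ?mulr_ge0// lef_pV2 ?posrE// exprS ler_peMl// ler1n.
have q0 j : 0 < 2 ^- j :> R by rewrite invr_gt0.
have tc j := cutf_testclass M_gt0 MM chi_jet chi0 chi_bound (q0 j) a0 Zc.
have Tg j := T_cvg (admissible3 aa) (tc j).
split.
  have stepg j : `|g (ck j.+1 phi) - g (ck j phi)| <= c1 * b / 2 ^+ j.
    by apply: (@norm_lim_le _ _ _ _ l1 (cvgB (Tg j.+1) (Tg j))) => l ll; exact: stepT.
  have [z [uz zb]] := geometric_lim stepg.
  exists z; split => //; last by move=> j; exact: le_trans (zb j) (le12 j).
  have g0 : `|g (ck 0 phi)| <= c2 * b.
    by apply: (@norm_lim_le _ _ _ _ l2 (Tg 0%N)) => l ll; exact: H2.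
  have := zb 0%N; rewrite expr0 divr1 => z0.
  rewrite -(subrK (g (ck 0 phi)) z); apply: le_trans (ler_normD _ _) _.
  by rewrite mulrDl lerD// -mulrA.
move=> l; rewrite ge_max => /andP[ll1 ll2].
have Ll := le_trans Ll1 ll1; have l1' := le_trans L0_ge1 Ll.
have lp : 0 < l by exact: lt_le_trans l1'.
have [w [uw wb]] := geometric_lim (fun j => stepT l j ll1).
exists w; split; last by move=> j; exact: le_trans (wb j) (le12 j).
have [m /andP[m1 m2]] := dyadic_floor l1'.
(* The cutoff of index [j + m] of the dilated function is the dilation of [phi] cut at [s * 2 ^- j];
   the discrepancy with [ck j phi] is a ring with ratio [s], negligible by [T_piece]. *)
pose s := l / 2 ^+ m.
have s12 : 1 <= s <= 2.
  by rewrite /s ler_pdivlMr// mul1r m1 ler_pdivrMr// -exprS.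
rewrite -(cvg_shiftn m).
have E j : f (ck (j + m) (fun x => phi (l^-1 * x))) = (N l * l) *: T l (cutf dchi (s * 2 ^- j) phi).
  rewrite -T_f//; congr f; apply/funext => x; rewrite /ck /cutf; congr (dchi 0%N _ *: _).
  by rewrite /s exprD; field; rewrite !gt_eqF.
under eq_fun do rewrite E.
apply: cvgZr.
have d0 : (fun j => T l (ck j phi) - T l (cutf dchi (s * 2 ^- j) phi)) @ \oo --> (0 : C).
  apply/cvgrPdist_le => e e0.
  have /cvgrPdist_le /(_ _ e0) : (fun j => c1 * b / 2 ^+ j) @ \oo --> (0 : R).
    rewrite -[X in _ --> X](mulr0 (c1 * b)); apply: cvgM; first exact: cvg_cst.
    rewrite (_ : (fun _ => _) = (fun i => 2^-1 ^+ i)); last by apply/funext => i; rewrite exprVn.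
    by apply: cvg_expr; rewrite ger0_norm; lra.
  apply: filterS => j; rewrite !sub0r !normrN; apply: le_trans.
  by apply: le_trans (H1 s j l phi b s12 ll1 Zc Zb1) _; exact: ler_norm.
have -> : (fun j => T l (cutf dchi (s * 2 ^- j) phi)) = (fun j => T l (ck j phi)) -
    (fun j => T l (ck j phi) - T l (cutf dchi (s * 2 ^- j) phi)).
  by apply/funext => j; rewrite -[RHS]/(_ - (_ - _)) subKr.
by have := cvgB uw d0; rewrite subr0; apply.
Qed.

Lemma cutlim_D (S : fct -> C) phi : carrier (D_space k M) phi -> cutlim S phi = S phi.
Proof.
move=> /D_supp[r Hr]; apply: cutlimE; apply: cvg_near_cst.
exists (Num.truncn r).+1 => // j /= rj; congr S; apply/funext => x.
have [/Hr xr|xr] := ltP r `|x|; first by rewrite /ck /cutf xr scaler0.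
rewrite /ck /cutf chi1 ?scale1r// normrM ger0_norm ?invr_ge0 ?exprn_ge0//.
rewrite ler_pdivrMl// mulr1 (le_trans xr)// (le_trans (ltW (truncnS_gt r)))//.
rewrite (le_trans (_ : _ <= j%:R))//; first by rewrite ler_nat.
by rewrite -natrX ler_nat ltnW// ltn_expl.
Qed.

Lemma cutlim_quasiasymptotic :
  quasiasymptotic (Z_space k M) alpha L (cutlim f) (cutlim g).
Proof.
split.
- apply: (@Z_dual _ _ _ M_gt0 n) => a aa; have a0 := admissible_ge0 aa;
    have [h [c [ah c0 H]]] := f_extension aa.
    apply: cutlim_linear => //.
      by move=> r; exact: (D_dual_linear M_gt0 df (admissible3 aa)).
    move=> phi Zc; have [_ /(_ _ ah)[b Zb]] := Zc.
    by have [z [? _]] := H _ _ Zc Zb; exists z.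
  exists h, c; split => // phi b Zc Zb; have [z [uz zb]] := H _ _ Zc Zb.
  by rewrite (cutlimE uz).
- apply: (@Z_dual _ _ _ M_gt0 n) => a aa; have a0 := admissible_ge0 aa;
    have [h [c [l0 [ah _ c0 H]]]] := g_extension aa.
    apply: cutlim_linear => //.
      by move=> r; exact: (D_dual_linear M_gt0 dg (admissible3 aa)).
    move=> phi Zc; have [_ /(_ _ ah)[b Zb]] := Zc.
    by have [[z [? _ _]] _] := H _ _ Zc Zb; exists z.
  exists h, c; split => // phi b Zc Zb; have [[z [uz zb _]] _] := H _ _ Zc Zb.
  by rewrite (cutlimE uz).
move=> phi /(Z_carrier M_gt0 n)[a aa Zc]; have a0 := admissible_ge0 aa.
have [h [c [l0 [ah Ll0 c0 H]]]] := g_extension aa.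
have [_ /(_ _ ah)[b Zb]] := Zc.
have b0 := Zbound_ge0 M_gt0 Zb.
have [[z [uz _ zb]] Hw] := H _ _ Zc Zb.
rewrite (cutlimE uz); apply/cvgrPdist_le => e e0.
(* With [j] fixed, both tails are at most [e / 3] for all [l >= l0]; only the compactly supported
   [ck j phi] is left for the limit in [l]. *)
have [j je] : exists j, c * b / 2 ^+ j <= e / 3.
  exists (Num.truncn (c * b / (e / 3))).+1.
  rewrite ler_pdivrMr// [e / 3 * _]mulrC -ler_pdivrMr; last by lra.
  apply: le_trans (ltW (truncnS_gt _)) _; rewrite -natrX ler_nat ltnW// ltn_expl//.
have q0 : 0 < 2 ^- j :> R by rewrite invr_gt0.
have tc := cutf_testclass M_gt0 MM chi_jet chi0 chi_bound q0 a0 Zc.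
have e3 : 0 < e / 3 by lra.
have /cvgrPdist_le /(_ _ e3) := T_cvg (admissible3 aa) tc.
apply: filterS2 (nbhs_pinfty_ge (num_real l0)) => l ll; rewrite -/(N l) -/(ck j phi) => Tl.
have [w [fw wb]] := Hw l ll; have Ll := le_trans Ll0 ll.
have lp : 0 < l by rewrite (lt_le_trans ltr01)// (le_trans L0_ge1).
rewrite dilateE (cutlimE fw) !scalerA (_ : _ * _ = 1) ?scale1r; last first.
  by field; rewrite !gt_eqF ?N_gt0.
apply: le_trans (ler_distD (g (ck j phi)) _ _) _.
have h1 := le_trans (zb j) je.
have h2 : `|g (ck j phi) - w| <= e / 3 + e / 3.
  apply: le_trans (ler_distD (T l (ck j phi)) _ _) _; rewrite lerD//.
  by rewrite distrC (le_trans (wb j)).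
by move: h1 h2; lra.
Qed.

End extension.

Theorem theorem5p1 (R : realType) (M : nat -> R) (k : ultra_kind)
    (alpha : R) (L : R -> R) (f g : (R -> Rcomplex R) -> Rcomplex R) :
  weight_sequence M -> slowly_varying L ->
  quasiasymptotic (D_space k M) alpha L f g ->
  exists F G : (R -> Rcomplex R) -> Rcomplex R,
    [/\ forall phi, carrier (D_space k M) phi -> F phi = f phi,
        forall phi, carrier (D_space k M) phi -> G phi = g phi
      & quasiasymptotic (Z_space k M) alpha L F G].
Proof.
move=> WM /slowly_varying_double[L0 L01 LL] quasi.
have M0 := weight_gt0 WM; have MM := weightM WM.
have [d [jd d1 d0 db]] := cutoff_exists WM.
(* For negative [alpha + 3] the truncation is 0 and [n = 1], which still satisfies the bound. *)
pose n := (Num.truncn (alpha + 3)).+1.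
have n_ge : alpha + 3 <= n%:R by apply/ltW/truncnS_gt.
exists (cutlim d f), (cutlim d g); split.
- by move=> phi; exact: (cutlim_D d1).
- by move=> phi; exact: (cutlim_D d1).
- exact: (cutlim_quasiasymptotic M0 MM jd d1 d0 db L01 LL n_ge quasi).
Qed.
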